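(* Let $h^*$ be the unique real polynomial of degree at most $2$ minimizing $\max_{t\in[0,1]}\left|\frac{h(t)}{\sqrt{1+t^2}}-1\right|$ among all real polynomials $h$ of degree at most $2$. Then the first interior alternation point $t_1$ of $h^*$ is a root of the polynomial $$\begin{aligned} Q(x) ={} & 4x^{12} - 32x^{11} + 36x^{10} + 56x^9 + 211x^8 + 228x^7\\ & + 250x^6 + 136x^5 + 81x^4 + 32x^3 + 18x^2 - 4x - 1, \end{aligned}$$ which is irreducible over $\mathbb{Q}$ and has Galois group over $\mathbb{Q}$ equal to the symmetric group $S_{12}$ (of order $479{,}001{,}600$). Moreover, $Q$ does not factor over any quadratic or cubic extension of $\mathbb{Q}$.
   Context: The optimal relative error $e(t)=h^*(t)/\sqrt{1+t^2}-1$ attains its maximum absolute value on $[0,1]$ with alternating signs at exactly four points $0<t_1<t_2<1$ together with the endpoints, i.e. at $0,t_1,t_2,1$. The first interior alternation point is $t_1$. *)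

(* Defs.v *)
From HB Require Import structures.
From mathcomp Require Import all_boot all_order all_algebra all_fingroup.
From mathcomp Require Import all_solvable all_field.
From mathcomp Require Import all_classical all_reals.

Set Implicit Arguments.
Unset Strict Implicit.
Unset Printing Implicit Defensive.

Import Order.TTheory GRing.Theory Num.Theory.

Local Open Scope classical_set_scope.
Local Open Scope ring_scope.

(* The signed error of [h] at [t], relative to [sqrt (1 + t^2)]. *)
Definition relerr (R : realType) (h : {poly R}) (t : R) : R :=
  h.[t] / Num.sqrt (1 + t ^+ 2) - 1.

(* The supremum is a maximum, [relerr h] being continuous on [0, 1]. *)
Definition maxerr (R : realType) (h : {poly R}) : R :=
  sup [set `|relerr h t| | t in [set t : R | 0 <= t <= 1]].

Definition best_quadratic (R : realType) (h : {poly R}) : Prop :=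
  (size h <= 3)%N /\
  forall g : {poly R}, (size g <= 3)%N -> maxerr h <= maxerr g.

(* [0, t1, t2, 1] is the complete increasing list of the points of [0, 1] where
   the error of [h] has maximal absolute value, and its signs alternate there;
   [t1] is thus the first interior alternation point of [h]. *)
Definition alternation_points (R : realType) (h : {poly R}) (t1 t2 : R) : Prop :=
  [/\ 0 < t1, t1 < t2, t2 < 1,
      [set t : R | 0 <= t <= 1 /\ `|relerr h t| = maxerr h]
        = [set t : R | t \in [:: 0; t1; t2; 1]]
    & [/\ relerr h 0 * relerr h t1 < 0,
          relerr h t1 * relerr h t2 < 0
        & relerr h t2 * relerr h 1 < 0]].

Definition Qpoly : {poly rat} :=
  4 *: 'X^12 - 32 *: 'X^11 + 36 *: 'X^10 + 56 *: 'X^9 + 211 *: 'X^8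
  + 228 *: 'X^7 + 250 *: 'X^6 + 136 *: 'X^5 + 81 *: 'X^4 + 32 *: 'X^3
  + 18 *: 'X^2 - 4 *: 'X - 1.

(* Main.v *)
(* Approximation. Write h = c (t^2 + b t + a). The critical points of
   h / sqrt (1 + t^2) are the roots of t^3 + (2 - a) t + b, so t1 and t2 determine
   a and b. Equating the errors at 0 and t2, and at t1 and 1, leaves two algebraic
   equations in t1 and t2, solved by a rational parametrization and the
   intermediate value theorem, and Q(t1) = 0 follows by elimination. Optimality
   and uniqueness come from the third divided difference at the four points.

   Galois group. Q has the same splitting field as its reciprocal polynomial, which
   is integral and monic up to sign. For a prime p and a ring morphism from the
   algebraic integers to a field of characteristic p, some Galois element induces
   the Frobenius on the reductions of the roots. For p = 5 this is an 11-cycle,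
   and for p = 71 one of its powers is a transposition; as Q has no rational root,
   the group is doubly transitive and contains all transpositions.

   Small extensions. If K has degree at most 3, then for every Galois element x
   one of x, x^2, x^3 fixes a generator of K, and so does x^6. The sixth powers of
   the elements of S_12 act transitively, hence Q stays irreducible over K. *)

Require Import Defs.
From Stdlib Require Import BinNat.
From HB Require Import structures.
From mathcomp Require Import all_boot all_order all_algebra all_fingroup.
From mathcomp Require Import all_solvable all_field.
From mathcomp Require Import all_classical all_reals.

From mathcomp Require Import ring lra zify.

Set Implicit Arguments.
Unset Strict Implicit.
Unset Printing Implicit Defensive.

Import Order.TTheory GRing.Theory Num.Theory.

Local Open Scope ring_scope.

(** * Frobenius elements *)

Lemma exists_proper_maximal_ideal (A : comNzRingType) (p : A) :
  (forall a, p * a <> 1) ->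
  exists2 J : {pred A}, idealr_closed J & p \in J /\
    forall x, x \notin J -> exists a, 1 - x * a \in J.
Proof.
move=> p_nunit.
pose closed (J : set A) := J p /\ forall a u v, J u -> J v -> J (a * u + v).
pose P (J : set A) := J = set0 \/ (closed J /\ ~ J 1).
have [F PF totF|J [PJ maxJ]] := @Zorn_bigcup A P.
  have [[X0 [FX0 X0n0]]|F0] := pselect (exists X, F X /\ X <> set0); last first.
    left; apply/seteqP; split=> // x [X FX Xx]; apply: F0.
    by exists X; split=> // Xn; rewrite Xn in Xx.
  have cl X : F X -> X <> set0 -> closed X /\ ~ X 1 by move=> /PF[].
  right; split; last first.
    move=> [X FX X1]; case: (cl X FX) => // Xn.
    by rewrite Xn in X1.
  split; first by exists X0 => //; exact: (cl _ FX0 X0n0).1.1.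
  move=> a u v [X FX Xu] [Y FY Yv].
  have n0 (Z : set A) z : Z z -> Z <> @set0 A by move=> Zz Z0; rewrite Z0 in Zz.
  case: (totF _ _ FX FY) => [XY|YX].
    have [[_ linY] _] := cl Y FY (n0 _ _ Yv).
    by exists Y => //; apply: linY => //; apply: XY.
  have [[_ linX] _] := cl X FX (n0 _ _ Xu).
  by exists X => //; apply: linX => //; apply: YX.
have [Jcl J1] : closed J /\ ~ J 1.
  (* A maximal [J] is not empty: the principal ideal [p A] satisfies [P], being proper because [p]
     is not a unit. *)
  case: PJ => // J0; pose B : set A := [set p * a | a in setT]%classic.
  have B0 : B 0 by exists 0 => //; rewrite mulr0.
  case: (maxJ B).
    by rewrite J0; split=> // /(_ _ B0).
  right; split; last by move=> [a _ /p_nunit].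
  split; first by exists 1 => //; rewrite mulr1.
  by move=> a _ _ [x _ <-] [y _ <-]; exists (a * x + y) => //; ring.
case: Jcl => Jp Jlin.
have J0 : J 0 by have := Jlin (-1) _ _ Jp Jp; rewrite mulN1r addNr.
exists (fun x => `[< J x >]).
  split; first exact/asboolP.
    by apply/negP => /asboolP.
  by move=> a u v /asboolP Ju /asboolP Jv; apply/asboolP/Jlin.
split=> [|x]; first exact/asboolP.
move=> nJx; have Jx : ~ J x by move=> /asboolP; exact/negP.
(* [B] is the ideal [J + x A]; as it contains [x], maximality forces [1] into it. *)
pose B : set A := [set u | exists a, J (u - x * a)]%classic.
have JB u : J u -> B u by move=> Ju; exists 0; rewrite mulr0 subr0.
have [[a Ja]|B1] := pselect (B 1); first by exists a; exact/asboolP.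
case: (maxJ B).
  split=> [//|/(_ x)BJ]; apply/Jx/BJ; exists 1.
  by rewrite mulr1 subrr.
right; split=> //; split; first exact: JB.
move=> a u v [b Jb] [c Jc]; exists (a * b + c).
have -> : a * u + v - x * (a * b + c) = a * (u - x * b) + (v - x * c) by ring.
exact: Jlin.
Qed.

Lemma rmorphism_to_field (A k0 : comNzRingType) (pi : {rmorphism A -> k0}) :
  (forall x : k0, exists y : k0, x != 0 -> y * x = 1) ->
  exists (k : fieldType) (phi : {rmorphism A -> k}), forall x, pi x = 0 -> phi x = 0.
Proof.
move=> inv_ex.
have [inv invP] := choice inv_ex.
pose inv' x : k0 := if x == 0 then 0 else inv x.
have inv'V x : x != 0 -> inv' x * x = 1.
  by rewrite /inv' => x0; rewrite (negPf x0) invP.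
have inv'0 : inv' 0 = 0 by rewrite /inv' eqxx.
pose k : fieldType := HB.pack (GRing.ComNzRing.sort k0)
  (GRing.ComNzRing_isField.Build k0 inv'V inv'0).
by exists k, pi.
Qed.

Lemma exists_residue_field (A : comNzRingType) (p : A) :
  (forall a, p * a <> 1) ->
  exists (k : fieldType) (phi : {rmorphism A -> k}), phi p = 0.
Proof.
move=> /exists_proper_maximal_ideal[J0 Jcl [Jp Jmax]].
pose J : idealr A := HB.pack J0 (isIdealr.Build A J0 Jcl).
pose k0 : comNzRingType := {ideal_quot J}.
pose pi : {rmorphism A -> k0} := \pi_k0%qT.
have pi0 x : (pi x == 0) = (x \in J0).
  by rewrite -[x in RHS]subr0 (Quotient.idealrBE J) -/(pi x) raddf0.
have inv_ex (x : k0) : exists y : k0, x != 0 -> y * x = 1.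
  have [a ->] : exists a, x = pi a by exists (generic_quotient.repr x); rewrite /= reprK.
  rewrite pi0.
  have [_|/Jmax[b Jb]] := boolP (a \in J0); first by exists 0.
  exists (pi b) => _; apply/eqP; rewrite eq_sym -subr_eq0.
  by rewrite -(rmorph1 pi) mulrC -rmorphM -rmorphB pi0.
have [k [phi phi0]] := rmorphism_to_field pi inv_ex.
by exists k, phi; apply/phi0/eqP; rewrite pi0.
Qed.

Record algint := AlgInt { algint_val : algC; _ : algint_val \in Aint }.

HB.instance Definition _ := [isSub for algint_val].
HB.instance Definition _ := [Choice of algint by <:].
HB.instance Definition _ := [SubChoice_isSubComNzRing of algint by <:].

(** [p] is not a unit among the algebraic integers: its inverse would be a rational algebraic
    integer, hence an integer. *)
Lemma algint_residue_field (p : nat) : prime p ->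
  exists (k : fieldType) (phi : {rmorphism algint -> k}), p \in [pchar k].
Proof.
move=> p_pr; have p_gt0 := prime_gt0 p_pr.
have [|k [phi phip]] := @exists_residue_field algint p%:R.
  move=> a /(congr1 val); rewrite rmorphM rmorph_nat rmorph1 /= => pa1.
  have aE : val a = p%:R^-1.
    by apply: (mulfI (x := p%:R)); rewrite ?pa1 ?mulfV // pnatr_eq0 -lt0n.
  have /intrP[m am] : val a \in Num.int.
    by apply: Cint_rat_Aint (valP a); rewrite aE rpredV rpred_nat.
  move: pa1; rewrite am -[p%:R]/((p%:Z)%:~R) -intrM => /(@intr_inj _ _ 1).
  move=> /(congr1 absz); rewrite abszM /= => /eqP; rewrite muln_eq1 => /andP[/eqP p1 _].
  by rewrite p1 in p_pr.
by exists k, phi; rewrite inE p_pr -(rmorph_nat phi) phip eqxx.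
Qed.

Lemma galois_over_rat (L : splittingFieldType rat) : galois 1 {:L}.
Proof.
rewrite /galois sub1v normalFieldf andbT.
by apply/separableP => x _; apply: pcharf0_separable => q; rewrite (pchar_lalg L) pchar_num.
Qed.

Lemma map_prod_XsubC (R S : comNzRingType) (h : {rmorphism R -> S}) (I : Type)
    (r : seq I) (F : I -> R) :
  map_poly h (\prod_(i <- r) ('X - (F i)%:P)) = \prod_(i <- r) ('X - (h (F i))%:P).
Proof. by rewrite rmorph_prod; apply: eq_bigr => i _; rewrite /= map_polyXsubC. Qed.

Lemma map_intr_poly (R S : nzRingType) (h : {rmorphism R -> S}) (f : {poly int}) :
  map_poly h (map_poly intr f) = map_poly intr f.
Proof. by rewrite -map_poly_comp; apply: eq_map_poly => m /=; rewrite rmorph_int. Qed.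

(* The polynomial [\prod_s (Y - \sum_i s(r_i) X^i)], for [s] in the Galois group,
   has integer coefficients, so its image over [k] is fixed by the Frobenius,
   which therefore permutes its roots [\sum_i psi (s r_i) X^i]. *)
Lemma frobenius_exists (L : splittingFieldType rat) (iota : {rmorphism L -> algC})
    (rs : seq L) (f : {poly int}) (p : nat) :
  prime p -> map_poly intr f = \prod_(r <- rs) ('X - r%:P) ->
  exists (k : fieldType) (psi : L -> k) (s : gal_of {:L}),
    [/\ p \in [pchar k], map_poly intr f = \prod_(r <- rs) ('X - (psi r)%:P)
      & {in rs, forall r, psi (s r) = psi r ^+ p}].
Proof.
move=> p_pr fE; have [k [phi pk]] := algint_residue_field p_pr.
(* The default 0 is never met: [toA] is evaluated only at conjugates of the roots, which are
   algebraic integers. *)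
pose toA (x : L) : algint := insubd 0 (iota x).
have toAK x : iota x \in Aint -> val (toA x) = iota x by move=> xA; rewrite insubdK.
pose T := gal_of {:L}.
pose v : {rmorphism algint -> algC} := val.
have rootf (s : T) r : root (map_poly intr f) r -> root (map_poly intr f) (s r).
  by rewrite -[in X in _ -> X](map_intr_poly s) fmorph_root.
have rsA (s : T) r : r \in rs -> iota (s r) \in Aint.
  move=> r_rs; have : root (map_poly intr f) (s r).
    by apply: rootf; rewrite fE root_prod_XsubC.
  rewrite -(fmorph_root iota) map_intr_poly => rt.
  apply: (root_monic_Aint rt).
    by rewrite -(map_intr_poly iota) map_monic fE monic_prod_XsubC.
  apply/polyOverP => i; rewrite coef_map /=; exact: intr_int.
have rsA1 r : r \in rs -> iota r \in Aint by move=> /(rsA 1%g); rewrite gal_id.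
exists k, (phi \o toA).
pose n := size rs.
pose TL (s : T) : {poly L} := \poly_(i < n) s rs`_i.
pose TA (s : T) : {poly algint} := \poly_(i < n) toA (s rs`_i).
pose ML : {poly {poly L}} := \prod_s ('X - (TL s)%:P).
pose MA : {poly {poly algint}} := \prod_s ('X - (TA s)%:P).
have MLA : map_poly (map_poly v) MA = map_poly (map_poly iota) ML.
  rewrite !map_prod_XsubC; apply: eq_bigr => s _.
  suff E : map_poly v (TA s) = map_poly iota (TL s).
    exact: (congr1 (fun q => 'X - q%:P) E).
  apply/polyP => i; rewrite !coef_map !coef_poly.
  by case: ifP => [ltin|_]; [rewrite [LHS]toAK // rsA // mem_nth | rewrite [RHS]rmorph0; exact: (rmorph0 v)].
(* Multiplication by [t] permutes the factors of the product. *)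
have MLinv (t : T) : map_poly (map_poly t) ML = ML.
  rewrite map_prod_XsubC [RHS](reindex_inj (mulIg t)); apply: eq_bigr => s _.
  suff E : map_poly t (TL s) = TL (s * t)%g.
    exact: (congr1 (fun q => 'X - q%:P) E).
  apply/polyP => i; rewrite !coef_map !coef_poly /=.
  by case: ifP => [ltin|_]; rewrite ?rmorph0 // galM ?memvf.
(* The coefficients are Galois-invariant, hence rational, and they are algebraic integers. *)
have MAint i j : exists m : int, MA`_i`_j = m%:~R.
  have : v MA`_i`_j = iota ML`_i`_j.
    by have := congr1 (fun q : {poly {poly algC}} => q`_i`_j) MLA; rewrite !coef_map.
  have /vlineP[a ->] : ML`_i`_j \in 1%VS.
    have /galois_fixedField <- := galois_over_rat L.
    apply/fixedFieldP; first exact: memvf.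
    by move=> t _; rewrite -[in RHS](MLinv t) !coef_map.
  rewrite alg_num_field fmorph_rat => vE.
  have /intrP[m mE] : v MA`_i`_j \in Num.int.
    by apply: Cint_rat_Aint (valP _); rewrite [X in X \in _]vE; apply/CratP; exists a.
  by exists m; apply: val_inj; rewrite [LHS]mE -(rmorph_int v).
pose F : {rmorphism k -> k} := pFrobenius_aut pk.
pose Tk (s : T) : {poly k} := map_poly phi (TA s).
pose Mk : {poly {poly k}} := map_poly (map_poly phi) MA.
have MkE : Mk = \prod_s ('X - (Tk s)%:P) by rewrite /Mk map_prod_XsubC.
have MkF : map_poly (map_poly F) Mk = Mk.
  apply/polyP => i; rewrite coef_map; apply/polyP => j.
  rewrite coef_map /Mk !coef_map; have [m ->] := MAint i j.
  by rewrite -[LHS]/(F (phi m%:~R)) -[RHS]/(phi m%:~R) (rmorph_int phi) (rmorph_int F).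
(* [Tk 1] is a root of [Mk], so its Frobenius image is one too and equals some [Tk s]; comparing
   coefficients gives the congruences for this [s]. *)
have : root Mk (map_poly F (Tk 1%g)).
  rewrite -MkF {1}MkE map_prod_XsubC (bigD1 1%g) //=.
  by rewrite rootM root_XsubC eqxx.
rewrite MkE /root horner_prod => /prodf_eq0[s _].
rewrite hornerXsubC subr_eq0 => /eqP sE; exists s; split=> //.
  have fA : map_poly intr f = \prod_(r <- rs) ('X - (toA r)%:P).
    apply: (map_inj_poly val_inj (rmorph0 v)).
    rewrite (map_intr_poly v) (map_prod_XsubC v).
    rewrite -(map_intr_poly iota) fE map_prod_XsubC; apply: eq_big_seq => r r_rs.
    by rewrite [v _]toAK // rsA1.
  by rewrite -(map_intr_poly phi) fA map_prod_XsubC.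
move=> r /(nthP 0)[i ltin <-].
have := congr1 (fun q : {poly k} => q`_i) sE.
by rewrite !coef_map !coef_poly ltin gal_id /= => <-.
Qed.

(** * Reductions modulo 5 and 71 *)

(* The monic reciprocal polynomial [- X^12 Q(1/X)], whose roots are the inverses
   of those of [Q]. *)
Definition revQ : {poly int} :=
  'X^12 + 4%:Z *: 'X^11 - 18%:Z *: 'X^10 - 32%:Z *: 'X^9 - 81%:Z *: 'X^8
  - 136%:Z *: 'X^7 - 250%:Z *: 'X^6 - 228%:Z *: 'X^5 - 211%:Z *: 'X^4
  - 56%:Z *: 'X^3 - 36%:Z *: 'X^2 + 32%:Z *: 'X - 4%:Z *: 1.

(* Polynomials modulo [p] are lists of binary coefficients, constant term first. *)
Fixpoint evalN (k : comNzRingType) (x : k) (l : seq N) : k :=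
  if l is c :: l' then (nat_of_bin c)%:R + x * evalN x l' else 0.

Lemma nat_of_addN (a b : N) : nat_of_bin (a + b)%num = (nat_of_bin a + nat_of_bin b)%N.
Proof. lia. Qed.

Lemma nat_of_mulN (a b : N) : nat_of_bin (a * b)%num = (nat_of_bin a * nat_of_bin b)%N.
Proof. lia. Qed.

(* The modulus is the monic polynomial [X^(size m) - m]. *)
Section ModularArithmetic.
Variables (p : N) (m : seq N).

Fixpoint axpyN (c : N) (a b : seq N) : seq N :=
  match a, b with
  | x :: a', y :: b' => N.modulo (x + c * y) p :: axpyN c a' b'
  | [::], _ => [seq N.modulo (c * y) p | y <- b]
  | _, [::] => a
  end.

(** Only one coefficient can overflow, since [mulN] follows Horner's scheme and reduces after each
    multiplication by X. *)
Definition reduceN (a : seq N) : seq N :=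
  if drop (size m) a is [:: c] then axpyN c (take (size m) a) m else a.

Definition mulN (a b : seq N) : seq N :=
  foldr (fun c acc => axpyN c (reduceN (0%num :: acc)) b) [::] a.

Definition expN (a : seq N) (e : nat) : seq N := iter e (mulN a) [:: 1%num].

Definition frobN (j : nat) : seq N := iter j (expN ^~ p) [:: 0%num; 1%num].

Variables (k : comNzRingType) (x : k).
Hypothesis p0 : (nat_of_bin p)%:R = 0 :> k.
Hypothesis xm : x ^+ size m = evalN x m.

Lemma natr_modN c : (nat_of_bin (N.modulo c p))%:R = (nat_of_bin c)%:R :> k.
Proof.
have [-> //|pn0] := N.eq_dec p 0; first by case: c.
by rewrite [in RHS](N.div_mod c p pn0) nat_of_addN nat_of_mulN natrD natrM p0 mul0r add0r.
Qed.

Lemma evalN_axpy c a b :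
  evalN x (axpyN c a b) = evalN x a + (nat_of_bin c)%:R * evalN x b.
Proof.
elim: a b => [|u a IH] [|v b] /=; rewrite ?mulr0 ?addr0 ?add0r //.
  rewrite natr_modN nat_of_mulN natrM mulrDr mulrCA; congr (_ + x * _).
  elim: b => [|w b IHb] /=; first by rewrite mulr0.
  by rewrite natr_modN nat_of_mulN natrM mulrDr mulrCA IHb.
rewrite natr_modN nat_of_addN nat_of_mulN natrD natrM IH; ring.
Qed.

Lemma evalN_cat a b : evalN x (a ++ b) = evalN x a + x ^+ size a * evalN x b.
Proof. by elim: a => [|u a IH] /=; rewrite ?expr0 ?exprS ?IH; ring. Qed.

Lemma evalN_reduce a : evalN x (reduceN a) = evalN x a.
Proof.
rewrite /reduceN; case E : (drop (size m) a) => [|c [|]] //.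
have sa : (size m < size a)%N.
  by have := congr1 size E; rewrite size_drop /= => /eqP; rewrite -subn_gt0 => /eqP->.
rewrite evalN_axpy -[in RHS](cat_take_drop (size m) a) evalN_cat E.
by rewrite size_takel 1?ltnW // xm /= mulr0 addr0 mulrC.
Qed.

Lemma evalN_mul a b : evalN x (mulN a b) = evalN x a * evalN x b.
Proof.
elim: a => [|c a IH] /=; first by rewrite mul0r.
by rewrite evalN_axpy evalN_reduce /= IH; ring.
Qed.

Lemma evalN_exp a e : evalN x (expN a e) = evalN x a ^+ e.
Proof.
elim: e => [|e IH] /=; first by rewrite mulr0 addr0.
by rewrite evalN_mul IH exprS.
Qed.

Lemma evalN_frob j : evalN x (frobN j) = iter j (fun y => y ^+ nat_of_bin p) x.
Proof.
elim: j => [|j IH] /=; first by rewrite mulr0 addr0 mulr1 add0r.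
by rewrite evalN_exp IH.
Qed.

End ModularArithmetic.

Lemma evalN_horner (k : comNzRingType) (x : k) (l : seq N) :
  evalN x l = (Poly [seq (nat_of_bin c)%:R | c <- l]).[x].
Proof.
elim: l => [|c l IH] /=; first by rewrite horner0.
by rewrite horner_cons IH addrC mulrC.
Qed.

(** A polynomial that is nonzero modulo [p] and has degree below the number of the distinct [rs]
    cannot vanish at all of them. *)
Lemma evalN_roots (k : fieldType) (p : N) (rs : seq k) (l : seq N) :
  nat_of_bin p \in [pchar k] -> uniq rs -> (size l <= size rs)%N ->
  has (fun c => ~~ (nat_of_bin p %| nat_of_bin c)%N) l ->
  has (fun r => evalN r l != 0) rs.
Proof.
move=> pk urs sl /hasP[c cl pc]; apply/negPn/negP => /hasPn rs0.
pose P := Poly [seq (nat_of_bin c)%:R | c <- l] : {poly k}.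
have P0 : P = 0.
  apply: contraTeq (leq_trans (size_Poly _) _ : size P <= size rs)%N => [Pn0|]; last first.
    by rewrite size_map.
  rewrite -ltnNge max_poly_roots //; apply/allP => r /rs0.
  by rewrite negbK evalN_horner.
have := congr1 (fun q : {poly k} => q`_(index c l)) P0.
rewrite coef_Poly (nth_map 0%num) ?index_mem // nth_index // coef0 => /eqP.
by rewrite -(dvdn_pcharf pk) (negPf pc).
Qed.

Lemma uniq_roots_deriv (k : fieldType) (rs : seq k) :
  (forall r, r \in rs -> (\prod_(r <- rs) ('X - r%:P))^`().[r] != 0) -> uniq rs.
Proof.
(* Separability is coprimality with the derivative, which is then generalized to any polynomial
   without zero in [rs], so that induction applies. *)
move=> rs0; rewrite -separable_prod_XsubC separable_poly.unlock.
set P' := (_^`()); rewrite coprimep_sym.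
have : {in rs, forall r, P'.[r] != 0} by [].
elim: rs {rs0} P' => [|r rs IH] P' rs0; first by rewrite big_nil coprimep1.
rewrite big_cons coprimepMr IH; last by move=> s srs; apply: rs0; rewrite inE srs orbT.
by rewrite coprimep_XsubC /root rs0 ?mem_head.
Qed.

Lemma horner_prod_roots (k : fieldType) (f : {poly int}) (rs : seq k) :
  map_poly intr f = \prod_(r <- rs) ('X - r%:P) ->
  forall r, r \in rs -> (map_poly intr f).[r] = 0.
Proof. by move=> -> r rrs; apply/eqP; rewrite -/(root _ _) root_prod_XsubC. Qed.

(* [X^12] modulo [revQ] and modulo 5, resp. 71. *)
Definition nf5 : seq N := [:: 4; 3; 1; 1; 1; 3; 0; 1; 1; 2; 3; 1]%num.
Definition nf71 : seq N := [:: 4; 39; 36; 56; 69; 15; 37; 65; 10; 32; 18; 67]%num.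

Lemma map_revQ (k : comNzRingType) : map_poly intr revQ =
  'X^12 + 4 *: 'X^11 - 18 *: 'X^10 - 32 *: 'X^9 - 81 *: 'X^8
  - 136 *: 'X^7 - 250 *: 'X^6 - 228 *: 'X^5 - 211 *: 'X^4
  - 56 *: 'X^3 - 36 *: 'X^2 + 32 *: 'X - 4 *: 1 :> {poly k}.
Proof.
by rewrite /revQ; set S := RHS; rewrite !(rmorphD, rmorphN) /= !map_polyZ !map_polyXn map_polyX rmorph1.
Qed.

Lemma root_revQ (k : comNzRingType) (x : k) : (map_poly intr revQ).[x] = 0 ->
  x ^+ 12 = 4 - 32 * x + 36 * x ^+ 2 + 56 * x ^+ 3 + 211 * x ^+ 4 + 228 * x ^+ 5
    + 250 * x ^+ 6 + 136 * x ^+ 7 + 81 * x ^+ 8 + 32 * x ^+ 9 + 18 * x ^+ 10 - 4 * x ^+ 11.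
Proof.
rewrite map_revQ !hornerE => fx; apply/eqP; rewrite -subr_eq0 -fx; apply/eqP; ring.
Qed.

Lemma root_revQ5 (k : comNzRingType) (x : k) : 5 = 0 :> k ->
  (map_poly intr revQ).[x] = 0 -> x ^+ size nf5 = evalN x nf5.
Proof.
move=> p0 /root_revQ fx; rewrite fx /=; apply/eqP; rewrite -subr_eq0.
set d := (X in X == 0).
(* The cofactor collects the differences between the integral coefficients and their residues,
   divided by 5. *)
suff -> : d = 5 * (-7 * x + 7 * x ^+ 2 + 11 * x ^+ 3 + 42 * x ^+ 4 + 45 * x ^+ 5
    + 50 * x ^+ 6 + 27 * x ^+ 7 + 16 * x ^+ 8 + 6 * x ^+ 9 + 3 * x ^+ 10 - x ^+ 11).
  by rewrite p0 mul0r.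
rewrite /d; ring.
Qed.

Lemma root_revQ71 (k : comNzRingType) (x : k) : 71 = 0 :> k ->
  (map_poly intr revQ).[x] = 0 -> x ^+ size nf71 = evalN x nf71.
Proof.
move=> p0 /root_revQ fx; rewrite fx /=; apply/eqP; rewrite -subr_eq0.
set d := (X in X == 0).
suff -> : d = 71 * (- x + 2 * x ^+ 4 + 3 * x ^+ 5
    + 3 * x ^+ 6 + x ^+ 7 + x ^+ 8 - x ^+ 11).
  by rewrite p0 mul0r.
rewrite /d; ring.
Qed.

Lemma deriv_revQ (k : comNzRingType) (x : k) : (map_poly intr revQ)^`().[x] =
  32 - 72 * x - 168 * x ^+ 2 - 844 * x ^+ 3 - 1140 * x ^+ 4 - 1500 * x ^+ 5
    - 952 * x ^+ 6 - 648 * x ^+ 7 - 288 * x ^+ 8 - 180 * x ^+ 9 + 44 * x ^+ 10 + 12 * x ^+ 11.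
Proof.
rewrite map_revQ !(derivD, derivN, derivZ, derivXn, derivX, derivC).
rewrite !(hornerD, hornerN, hornerZ, hornerMn, hornerXn, hornerX, hornerC, horner0).
ring.
Qed.

Lemma size_revQ (k : comNzRingType) : size (map_poly intr revQ : {poly k}) = 13.
Proof.
rewrite map_revQ -!addrA size_polyDl size_polyXn // ltnS.
apply/leq_sizeP => j j12.
rewrite !(coefD, coefN, coefZ, coefXn, coefX, coef1).
by rewrite !gtn_eqF ?(leq_trans _ j12) // !mulr0 oppr0 !addr0.
Qed.

(* The derivative of [revQ], and below its inverse, modulo [revQ]. *)
Definition dnf5 : seq N := [:: 2; 3; 2; 1; 0; 0; 3; 2; 2; 0; 4; 2]%num.
Definition dnf71 : seq N := [:: 32; 70; 45; 8; 67; 62; 42; 62; 67; 33; 44; 12]%num.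
Definition inv5 : seq N := [:: 1; 2; 2; 2; 1; 2; 3; 4; 4; 3; 0; 2]%num.
Definition inv71 : seq N := [:: 48; 7; 20; 22; 45; 29; 26; 5; 66; 67; 46; 59]%num.
(* The quadratic factor of [revQ] modulo 71. *)
Definition quad71 : seq N := [:: 1; 34; 32]%num.

Lemma deriv_revQ5 (k : comNzRingType) (x : k) : 5 = 0 :> k ->
  (map_poly intr revQ)^`().[x] = evalN x dnf5.
Proof.
move=> p0; rewrite deriv_revQ /=; apply/eqP; rewrite -subr_eq0.
set d := (X in X == 0).
suff -> : d = 5 * (6 + (-15) * x + (-34) * x ^+ 2 + (-169) * x ^+ 3 + (-228) * x ^+ 4
    + (-300) * x ^+ 5 + (-191) * x ^+ 6 + (-130) * x ^+ 7 + (-58) * x ^+ 8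
    + (-36) * x ^+ 9 + 8 * x ^+ 10 + 2 * x ^+ 11) by rewrite p0 mul0r.
rewrite /d; ring.
Qed.

Lemma deriv_revQ71 (k : comNzRingType) (x : k) : 71 = 0 :> k ->
  (map_poly intr revQ)^`().[x] = evalN x dnf71.
Proof.
move=> p0; rewrite deriv_revQ /=; apply/eqP; rewrite -subr_eq0.
set d := (X in X == 0).
suff -> : d = 71 * ((-2) * x + (-3) * x ^+ 2 + (-12) * x ^+ 3 + (-17) * x ^+ 4
    + (-22) * x ^+ 5 + (-14) * x ^+ 6 + (-10) * x ^+ 7 + (-5) * x ^+ 8
    + (-3) * x ^+ 9) by rewrite p0 mul0r.
rewrite /d; ring.
Qed.

Section Roots.
Variables (k : fieldType) (rs : seq k).
Hypothesis rsE : map_poly intr revQ = \prod_(r <- rs) ('X - r%:P).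

Let rs0 r : r \in rs -> (map_poly intr revQ).[r] = 0.
Proof. exact: horner_prod_roots. Qed.

Lemma size_roots_revQ : size rs = 12.
Proof. by have := size_revQ k; rewrite rsE size_prod_XsubC => -[]. Qed.

Lemma revQ_mod5 : 5%N \in [pchar k] ->
  [/\ uniq rs, {in rs, forall r, iter 11 (fun y => y ^+ 5) r = r}
    & has (fun r => r ^+ 5 != r) rs].
Proof.
move=> pk; have p0 : (nat_of_bin 5%num)%:R = 0 :> k by apply/eqP; rewrite -(dvdn_pcharf pk).
have xm r : r \in rs -> r ^+ size nf5 = evalN r nf5 by move=> /rs0; exact: root_revQ5.
have urs : uniq rs.
  apply: uniq_roots_deriv => r rrs; rewrite -rsE deriv_revQ5 //.
  (* [inv5] inverts the derivative modulo [revQ], so the derivative vanishes at no root. *)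
  apply/eqP => d0; have := evalN_mul p0 (xm r rrs) dnf5 inv5.
  have -> : mulN 5 nf5 dnf5 inv5 = [:: 1; 0; 0; 0; 0; 0; 0; 0; 0; 0; 0; 0]%num by vm_compute.
  by rewrite d0 mul0r /= !(mulr0, addr0) => /eqP; rewrite oner_eq0.
split=> // [r rrs|].
  rewrite -(evalN_frob p0 (xm r rrs)).
  have -> : frobN 5 nf5 11 = [:: 0; 1; 0; 0; 0; 0; 0; 0; 0; 0; 0; 0]%num by vm_compute.
  by rewrite /= !(mulr0, addr0, add0r, mulr1).
(* The list is X^5 - X modulo 5, of degree below 12. *)
have := @evalN_roots k 5 rs [:: 0; 4; 0; 0; 0; 1]%num pk urs.
rewrite size_roots_revQ => /(_ isT isT); apply: sub_has => r; apply: contra => /eqP r5.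
have -> : evalN r [:: 0; 4; 0; 0; 0; 1]%num = (r ^+ 5 - r) + 5%:R * r by rewrite /=; ring.
by rewrite r5 subrr p0 mul0r addr0.
Qed.

Lemma revQ_mod71 : 71%N \in [pchar k] ->
  [/\ uniq rs, (count (fun r => iter 9 (fun y => y ^+ 71) r != r) rs <= 2)%N
    & has (fun r => iter 9 (fun y => y ^+ 71) r != r) rs].
Proof.
move=> pk; have p0 : (nat_of_bin 71%num)%:R = 0 :> k by apply/eqP; rewrite -(dvdn_pcharf pk).
have xm r : r \in rs -> r ^+ size nf71 = evalN r nf71 by move=> /rs0; exact: root_revQ71.
have urs : uniq rs.
  apply: uniq_roots_deriv => r rrs; rewrite -rsE deriv_revQ71 //.
  apply/eqP => d0; have := evalN_mul p0 (xm r rrs) dnf71 inv71.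
  have -> : mulN 71 nf71 dnf71 inv71 = [:: 1; 0; 0; 0; 0; 0; 0; 0; 0; 0; 0; 0]%num by vm_compute.
  by rewrite d0 mul0r /= !(mulr0, addr0) => /eqP; rewrite oner_eq0.
(* [l9] is X^(71^9) - X reduced modulo [revQ]; the factor 70 stands for -1. *)
pose l9 := axpyN 71 70 (frobN 71 nf71 9) [:: 0; 1]%num.
have l9E r : r \in rs -> evalN r l9 = iter 9 (fun y => y ^+ 71) r - r.
  move=> rrs; rewrite (evalN_axpy r p0) (evalN_frob p0 (xm r rrs)); congr (_ + _).
  apply/eqP; rewrite -subr_eq0 opprK /= mulr0 addr0 mulr1 add0r -[X in _ + X]mul1r -mulrDl.
  by rewrite -(natrD _ 70 1) p0 mul0r.
split=> //.
  (* The product of [quad71] and [l9] vanishes modulo [revQ], so a root moved by the ninth power of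
     the Frobenius is one of the at most two roots of [quad71]. *)
  have quad r : r \in rs -> iter 9 (fun y => y ^+ 71) r != r -> evalN r quad71 = 0.
    move=> rrs; rewrite -subr_eq0 -l9E // => l9n0; apply: (mulIf l9n0).
    rewrite -(evalN_mul p0 (xm r rrs)) mul0r.
    have -> : mulN 71 nf71 quad71 l9 = nseq 12 0%num by vm_compute.
    by rewrite /= !(mulr0, addr0).
  pose ss := [seq r <- rs | iter 9 (fun y => y ^+ 71) r != r].
  rewrite leqNgt -size_filter -/ss; apply/negP => lt2.
  have := @evalN_roots k 71 ss quad71 pk (filter_uniq _ urs) lt2 isT.
  move=> /hasP[r]; rewrite mem_filter => /andP[rn rrs].
  by rewrite quad ?eqxx.
have := @evalN_roots k 71 rs l9 pk urs.
have -> : (size l9 <= size rs)%N by rewrite size_roots_revQ; vm_compute.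
have -> : has (fun c => ~~ (nat_of_bin 71%num %| nat_of_bin c)%N) l9 by vm_compute.
move=> /(_ isT isT) /hasP[r rrs]; rewrite l9E // subr_eq0 => rn.
by apply/hasP; exists r.
Qed.

End Roots.

(** * The Galois group *)

(** The orbits of [c] have 1 or [q] elements; a nontrivial one has [q] and leaves out a single point
    [a]. *)
Lemma prime_cycle_support (T : finType) (q : nat) (c : {perm T}) :
  prime q -> #|T| = q.+1 -> (c ^+ q = 1)%g -> c != 1%g ->
  exists a, c a = a /\ forall b b', b != a -> b' != a -> exists m, (c ^+ m)%g b = b'.
Proof.
move=> q_pr cardT cq c1.
have cpo b : #|porbit c b| = 1 \/ #|porbit c b| = q.
  have : (#|porbit c b| %| q)%N.
    rewrite porbitE; apply: dvdn_trans (dvdn_orbit _ _ _) _.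
    by rewrite -orderE order_dvdn cq.
  by have [_ qP] := primeP q_pr => /qP/orP[]/eqP; [left|right].
have [b cb] : exists b, c b != b.
  apply/existsP; apply: contraNT c1; rewrite negb_exists => /forallP cid.
  by apply/eqP/permP => b; rewrite perm1; apply/eqP; have := cid b; rewrite negbK.
have cardb : #|porbit c b| = q.
  by case: (cpo b) => // c1b; have := iter_porbit c b; rewrite c1b /= => /eqP; rewrite (negPf cb).
have /cards1P[a aE] : #|~: porbit c b| == 1.
  by have := cardsC (porbit c b); rewrite cardT cardb => /eqP; rewrite -addn1 eqn_add2l.
have inb u : (u \in porbit c b) = (u != a).
  by rewrite -[LHS]negbK -finset.in_setC aE finset.in_set1.
exists a; split=> [|u v ua va].
  have na : a \notin porbit c b by rewrite inb negbK.
  apply/eqP; apply: contraNT na; rewrite -inb -!eq_porbit_mem => /eqP <-.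
  by rewrite -[c a]/((c ^+ 1)%g a) porbit_perm.
move: ua va; rewrite -!inb -!eq_porbit_mem => /eqP <- /[!eq_porbit_mem] /porbitP[m ->].
by exists m.
Qed.

(** The stabilizer of [a] is transitive on the other points and [a] is moved, so [G] is doubly
    transitive; the conjugates of one transposition are then all transpositions, and these
    generate. *)
Lemma perm_group_full (T : finType) (G : {group {perm T}}) (a x y : T) :
  (forall b b', b != a -> b' != a -> exists2 g, g \in G & g a = a /\ g b = b') ->
  (exists2 g, g \in G & g a != a) ->
  x != y -> tperm x y \in G -> G :=: [set: {perm T}].
Proof.
move=> transa [t tG ta] xy Gxy.
have to_a u : exists2 g, g \in G & g u = a.
  have [->|ua] := eqVneq u a; first by exists 1%g; rewrite ?group1 ?perm1.
  have [g gG [ga gu]] := transa _ _ ua ta.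
  by exists (g * t^-1)%g; rewrite ?groupM ?groupV // permM gu permK.
have trans2 u v : u != v -> exists2 g, g \in G & g x = u /\ g y = v.
  move=> uv; have [g1 G1 g1x] := to_a x; have [g2 G2 g2u] := to_a u.
  have [||h hG [ha hy]] := transa (g1 y) (g2 v).
  - by rewrite -g1x (inj_eq perm_inj) eq_sym.
  - by rewrite -g2u (inj_eq perm_inj) eq_sym.
  exists (g1 * h * g2^-1)%g; first by rewrite !groupM ?groupV.
  by rewrite !permM g1x ha hy -g2u !permK.
apply/eqP; rewrite finset.eqEsubset finset.subsetT; apply/fintype.subsetP => s _.
have [ts -> dts] := prod_tpermP s; rewrite big_seq.
apply: group_prod => -[u v] uv; have := allP dts _ uv; rewrite /dpair /= => {}uv.
have [g gG [<- <-]] := trans2 _ _ uv.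
by rewrite -tpermJ groupJ.
Qed.

(** * Embeddings and splitting fields of number fields *)

Lemma exists_rmorphism_adjoin (K : fieldExtType rat) (theta : K) (M : fieldType)
    (j : {rmorphism rat -> M}) (z : M) :
  <<1; theta>>%VS = {:K}%VS ->
  (forall q : {poly rat}, root (map_poly (in_alg K) q) theta -> root (map_poly j q) z) ->
  exists kappa : {rmorphism K -> M}, kappa theta = z.
Proof.
move=> gen rootq.
have polyE (x : K) : exists q : {poly rat}, (map_poly (in_alg K) q).[theta] = x.
  have /Fadjoin_polyP[p /polyOver1P[q ->] ->] : x \in <<1; theta>>%VS by rewrite gen memvf.
  by exists q.
have [q_ qE] := choice polyE.
(* An element is written as a polynomial in [theta] and evaluated at [z]; [rootq] makes the value
   independent of the polynomial. *)
pose kap x := (map_poly j (q_ x)).[z].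
have kapE x (q : {poly rat}) : (map_poly (in_alg K) q).[theta] = x -> kap x = (map_poly j q).[z].
  move=> qx; have : root (map_poly j (q_ x - q)) z.
    by apply: rootq; rewrite rmorphB /root hornerD hornerN /= qE qx subrr.
  by rewrite rmorphB /root hornerD hornerN subr_eq0 => /eqP.
have kapB : zmod_morphism kap.
  move=> x y; rewrite (kapE (x - y) (q_ x - q_ y)); last first.
    by rewrite rmorphB hornerD hornerN /= !qE.
  by rewrite rmorphB hornerD hornerN.
have kapM : monoid_morphism kap.
  split; first by rewrite (kapE 1 1) ?rmorph1 ?hornerC.
  move=> x y; rewrite (kapE (x * y) (q_ x * q_ y)); last first.
    by rewrite rmorphM hornerM /= !qE.
  by rewrite rmorphM hornerM.
pose kappa : {rmorphism K -> M} := HB.pack kap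
  (GRing.isZmodMorphism.Build K M kap kapB) (GRing.isMonoidMorphism.Build K M kap kapM).
exists kappa; rewrite [LHS](kapE theta 'X) ?map_polyX ?hornerX //.
Qed.

Lemma rat_primitive_element (K : fieldExtType rat) : exists theta : K, <<1; theta>>%VS = {:K}%VS.
Proof.
have sepK : separable 1 {:K}.
  by apply/separableP => x _; apply: pcharf0_separable => q; rewrite (pchar_lalg K) pchar_num.
by exists (separable_generator 1 {:K}); rewrite -eq_adjoin_separable_generator ?sub1v.
Qed.

Lemma rat_minPoly (K : fieldExtType rat) (theta : K) :
  exists2 m : {poly rat}, map_poly (in_alg K) m = minPoly 1 theta &
    forall q : {poly rat}, root (map_poly (in_alg K) q) theta -> m %| q.
Proof.
have /polyOver1P[m mE] := minPolyOver 1 theta; exists m => // q q0.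
rewrite -(dvdp_map (in_alg K)) -mE minPoly_dvdp //.
by apply/polyOver1P; exists q.
Qed.

Lemma exists_rmorphism_root (K : fieldExtType rat) (theta : K) (m : {poly rat})
    (M : fieldType) (j : {rmorphism rat -> M}) (z : M) :
  <<1; theta>>%VS = {:K}%VS -> map_poly (in_alg K) m = minPoly 1 theta ->
  root (map_poly j m) z -> exists kappa : {rmorphism K -> M}, kappa theta = z.
Proof.
move=> gen mE mz; apply: (exists_rmorphism_adjoin (j := j)) => // q.
have [m' m'E dvm] := rat_minPoly theta => /dvm.
have -> : m' = m by apply: (map_poly_inj (in_alg K)); rewrite m'E mE.
by move=> /dvdpP[d ->]; rewrite rmorphM rootM mz orbT.
Qed.

Lemma num_field_embedding (K : fieldExtType rat) : exists _ : {rmorphism K -> algC}, True.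
Proof.
have [theta gen] := rat_primitive_element K.
have [m mE _] := rat_minPoly theta.
have : size (map_poly (ratr : rat -> algC) m) != 1.
  by rewrite size_map_poly -(size_map_poly (in_alg K)) mE size_minPoly.
case/closed_rootP => z mz.
by have [kappa _] := exists_rmorphism_root gen mE mz; exists kappa.
Qed.

(** The field is generated by the complex roots of [p], inside which [p] splits. *)
Lemma exists_splitting_field (p : {poly rat}) : p != 0 ->
  exists (E : splittingFieldType rat) (rs : seq E),
    map_poly (in_alg E) p %= \prod_(r <- rs) ('X - r%:P).
Proof.
move=> p0; have [zs pE] := closed_field_poly_normal (map_poly (ratr : rat -> algC) p).
have [E [iota [rs rsE genE]]] := num_field_exists zs.
have pE' : map_poly (in_alg E) p %= \prod_(r <- rs) ('X - r%:P).
  rewrite -(eqp_map iota) map_prod_XsubC -map_poly_comp.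
  rewrite (eq_map_poly (g := ratr)); last by move=> a /=; rewrite alg_num_field fmorph_rat.
  rewrite pE -rsE big_map; apply: eqp_scale.
  by rewrite lead_coef_eq0 map_poly_eq0.
have ax : FieldExt_isSplittingField _ E.
  constructor; exists (map_poly (in_alg E) p); first by apply/polyOver1P; exists p.
  by exists rs.
exists (HB.pack_for (splittingFieldType rat) E ax).
by exists rs.
Qed.

Lemma tperm_of_support (T : finType) (t : {perm T}) (x : T) :
  (#|[pred y | t y != y]| <= 2)%N -> t x != x -> t = tperm x (t x).
Proof.
move=> le2 tx; have txx : t (t x) != t x by rewrite (inj_eq perm_inj).
have supp y : t y != y -> y = x \/ y = t x.
  move=> ty; have [->|yx] := eqVneq y x; first by left.
  have [->|ytx] := eqVneq y (t x); first by right.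
  suff : (2 < #|[pred y | t y != y]|)%N by rewrite ltnNge le2.
  have <- : #|[:: y; x; t x]| = 3%N.
    apply/card_uniqP; rewrite /= !inE negb_or yx ytx /= andbT eq_sym; exact: tx.
  by apply/subset_leq_card/fintype.subsetP => u; rewrite !inE => /or3P[]/eqP->.
apply/permP => y; have [->|yx] := eqVneq y x; first by rewrite tpermL.
have [->|ytx] := eqVneq y (t x).
  rewrite tpermR; have [|//|tt] := supp (t (t x)); first by rewrite (inj_eq perm_inj).
  by rewrite tt eqxx in txx.
rewrite tpermD 1?eq_sym //; have [//|/supp[] ty] := eqVneq (t y) y.
  by rewrite ty eqxx in yx.
by rewrite ty eqxx in ytx.
Qed.

(** There is no root even modulo 11, as a check of all residues shows. *)
Lemma revQ_no_int_root (z : int) : (map_poly intr revQ : {poly algC}).[z%:~R] != 0.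
Proof.
rewrite horner_map intr_eq0; apply/eqP => z0.
have : (map_poly intr revQ : {poly 'F_11}).[z%:~R] = 0 by rewrite horner_map z0.
move: (z%:~R) => x /root_revQ/eqP; apply/negP; case: x.
by do 11! [case=> [lex|]; first by vm_compute].
Qed.

(** * The Galois action on the roots *)

Lemma gal_map_rat_poly (L : splittingFieldType rat) (x : gal_of {:L}) (P : {poly rat}) :
  map_poly x (map_poly (in_alg L) P) = map_poly (in_alg L) P.
Proof. by rewrite -map_poly_comp; apply: eq_map_poly => a; rewrite /= linearZ rmorph1. Qed.

Section GaloisRoots.
Variables (L : splittingFieldType rat) (n : nat) (rs : n.-tuple L).

Lemma gal_permutes_roots (P : {poly rat}) :
  uniq rs -> map_poly (in_alg L) P %= \prod_(r <- rs) ('X - r%:P) ->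
  forall x : gal_of {:L}, exists s : 'S_n, forall i, x (tnth rs i) = tnth rs (s i).
Proof.
move=> urs PE x.
have xrs i : exists j, x (tnth rs i) = tnth rs j.
  suff /tnthP[j ->] : x (tnth rs i) \in rs by exists j.
  have root_rs r : root (map_poly (in_alg L) P) r = (r \in rs).
    by rewrite (eqp_root PE) root_prod_XsubC.
  rewrite -root_rs.
  by rewrite -(gal_map_rat_poly x) fmorph_root root_rs mem_tnth.
have [f fE] := choice xrs.
have finj : injective f.
  move=> i j /(congr1 (tnth rs)); rewrite -!fE => /fmorph_inj.
  by move/(tuple_uniqP rs): urs => /[apply].
by exists (perm finj) => i; rewrite permE.
Qed.

Definition gal_image : {set 'S_n} :=
  [set s : 'S_n | [exists x : gal_of {:L}, [forall i, x (tnth rs i) == tnth rs (s i)]]].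

Lemma gal_imageP (s : 'S_n) :
  reflect (exists x : gal_of {:L}, forall i, x (tnth rs i) = tnth rs (s i)) (s \in gal_image).
Proof.
rewrite inE; apply: (iffP existsP) => -[x xs]; exists x.
  by move=> i; apply/eqP; move/forallP: xs.
by apply/forallP => i; rewrite xs.
Qed.

Lemma gal_image_group_set : group_set gal_image.
Proof.
apply/group_setP; split=> [|s t /gal_imageP[x xs] /gal_imageP[y yt]].
  by apply/gal_imageP; exists 1%g => i; rewrite gal_id perm1.
by apply/gal_imageP; exists (x * y)%g => i; rewrite galM ?memvf // xs yt permM.
Qed.

Canonical gal_image_group := Group gal_image_group_set.

End GaloisRoots.

(** A root fixed by the whole Galois group is rational, and as an algebraic integer it is an
    integer. *)
Lemma int_root_of_fixed (L : splittingFieldType rat) (f : {poly int}) (r : L) :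
  f \is monic -> root (map_poly intr f) r -> (forall x : gal_of {:L}, x r = r) ->
  exists z : int, (map_poly intr f : {poly algC}).[z%:~R] = 0.
Proof.
move=> fmon fr xr; have [iota _] := num_field_embedding L.
have : root (map_poly intr f) (iota r) by rewrite -(map_intr_poly iota) fmorph_root.
move=> fir.
have /vlineP[a ra] : r \in 1%VS.
  have /galois_fixedField <- := galois_over_rat L.
  by apply/fixedFieldP => [|x _]; [exact: memvf | exact: xr].
have iA : iota r \in Aint.
  apply: (root_monic_Aint fir); first exact: monic_map.
  by apply/polyOverP => i; rewrite coef_map /=; exact: intr_int.
have /intrP[z zE] : iota r \in Num.int.
  by apply: Cint_rat_Aint iA; rewrite ra alg_num_field fmorph_rat; apply/CratP; exists a.
by exists z; rewrite -zE; apply/eqP.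
Qed.

Lemma monic_revQ : revQ \is monic.
Proof.
rewrite monicE /revQ -!addrA lead_coefDl ?lead_coefXn // size_polyXn ltnS.
apply/leq_sizeP => j j12; rewrite !(coefD, coefN, coefZ, coefXn, coefX, coef1).
by rewrite !gtn_eqF ?(leq_trans _ j12).
Qed.

(** The Frobenius element is read as a permutation of the indices. As the reductions of the roots
    are distinct, identities between iterated [p]-th powers of reductions lift to identities between
    powers of [s]. *)
Lemma frobenius_perm (L : splittingFieldType rat) (rs : 12.-tuple L) (p : nat) :
  prime p -> map_poly intr revQ = \prod_(r <- rs) ('X - r%:P) ->
  (forall k : fieldType, p \in [pchar k] -> forall ss : seq k,
    map_poly intr revQ = \prod_(r <- ss) ('X - r%:P) -> uniq ss) ->
  exists (k : fieldType) (psi : L -> k) (s : 'S_12),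
    [/\ p \in [pchar k], s \in gal_image rs,
      map_poly intr revQ = \prod_(r <- map psi rs) ('X - r%:P),
      uniq rs /\ injective (fun i => psi (tnth rs i))
      & forall i m, psi (tnth rs ((s ^+ m)%g i)) = iter m (fun y => y ^+ p) (psi (tnth rs i))].
Proof.
move=> p_pr fE Huniq; have [iota _] := num_field_embedding L.
have [k [psi [x [pk fpsi xpsi]]]] := frobenius_exists iota p_pr fE.
rewrite -[in RHS](big_map psi xpredT (fun r => 'X - r%:P)) in fpsi.
have ups := Huniq k pk _ fpsi; have urs := map_uniq ups.
have [|s sE] := @gal_permutes_roots L 12 rs (map_poly intr revQ) urs _ x.
  by rewrite (map_intr_poly (in_alg L)) fE eqpxx.
exists k, psi, s; split=> //.
- by apply/gal_imageP; exists x.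
- have /tuple_uniqP inj : uniq (map_tuple psi rs) by [].
  by split=> // i j /= psij; apply: inj; rewrite !tnth_map.
move=> i; elim=> [|m IH]; first by rewrite expg0 perm1.
by rewrite expgSr permM -sE xpsi ?mem_tnth // IH.
Qed.

(* Modulo 5, [revQ] is a product of factors of degrees 1 and 11; modulo 71, of
   degrees 1, 2 and 9, and the ninth power of the Frobenius is a transposition. *)
Lemma gal_image_revQ (L : splittingFieldType rat) (rs : 12.-tuple L) :
  map_poly intr revQ = \prod_(r <- rs) ('X - r%:P) ->
  uniq rs /\ gal_image rs = [set: 'S_12].
Proof.
move=> fE.
have [k5 [psi5 [c [p5 cG f5 [urs inj5] c5]]]] : _ :=
  frobenius_perm (isT : prime 5) fE (fun k pk ss ssE => let: And3 u _ _ := revQ_mod5 ssE pk in u).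
have [k71 [psi71 [s [p71 sG f71 [_ inj71] s71]]]] : _ :=
  frobenius_perm (isT : prime 71) fE (fun k pk ss ssE => let: And3 u _ _ := revQ_mod71 ssE pk in u).
split=> //.
have [_ c11 /hasP[r /mapP[r0 /tnthP[i0 ->] ->] ci0]] := revQ_mod5 f5 p5.
have c_11 : (c ^+ 11 = 1)%g.
  apply/permP => i; apply: inj5; rewrite c5 perm1 c11 //.
  by apply: map_f; exact: mem_tnth.
have c_1 : c != 1%g.
  apply: contraNneq ci0 => c1; have := c5 i0 1%N; rewrite /= => <-.
  by rewrite c1 expg1 perm1.
have [|a [ca ctrans]] := prime_cycle_support (isT : prime 11) _ c_11 c_1; first by rewrite card_ord.
have camm m : (c ^+ m)%g a = a by elim: m => [|m IH]; rewrite ?expg0 ?perm1 // expgSr permM IH.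
have [_ le2 /hasP[r' /mapP[r1 /tnthP[i1 ->] ->] si1]] := revQ_mod71 f71 p71.
pose t := (s ^+ 9)%g.
have tE i : (t i != i) = (iter 9 (fun y => y ^+ 71) (psi71 (tnth rs i)) != psi71 (tnth rs i)).
  by rewrite -s71 (inj_eq inj71).
have tx : t i1 != i1 by rewrite tE.
apply: (@perm_group_full _ (gal_image_group rs) a i1 (t i1)).
- move=> b b' ba b'a; have [m mE] := ctrans _ _ ba b'a.
  by exists (c ^+ m)%g; rewrite ?groupX.
(* If every element fixed [a], the corresponding root of [revQ] would be an integer. *)
- have [/exists_inP//|/exists_inPn fixa] := boolP [exists g in gal_image_group rs, g a != a].
  have [|||z] := @int_root_of_fixed L revQ (tnth rs a).
  + exact: monic_revQ.
  + by rewrite fE root_prod_XsubC mem_tnth.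
  + move=> x.
    have [|u uE] := @gal_permutes_roots L 12 rs (map_poly intr revQ) urs _ x.
      by rewrite (map_intr_poly (in_alg L)) fE eqpxx.
    rewrite uE; congr tnth; apply/eqP; rewrite -[_ == _]negbK; apply: fixa.
    by apply/gal_imageP; exists x.
  by move=> z0; have := revQ_no_int_root z; rewrite z0 eqxx.
- by rewrite eq_sym.
rewrite -(tperm_of_support _ tx) ?groupX //.
move: le2; rewrite count_map; apply: leq_trans.
rewrite cardE /enum_mem size_filter -enumT (eq_count (a2 := fun i => t i != i)) => [|i].
  rewrite -[X in (_ <= count _ X)%N]map_tnth_enum count_map.
  by apply/eq_leq/eq_count => i; rewrite tE.
by rewrite inE.
Qed.

(** * Transfer from [revQ] to [Qpoly] by inversion of the roots *)

Lemma horner_Qpoly (k : fieldType) (j : {rmorphism rat -> k}) (x : k) :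
  (map_poly j Qpoly).[x] = 4 * x ^+ 12 - 32 * x ^+ 11 + 36 * x ^+ 10 + 56 * x ^+ 9
    + 211 * x ^+ 8 + 228 * x ^+ 7 + 250 * x ^+ 6 + 136 * x ^+ 5 + 81 * x ^+ 4
    + 32 * x ^+ 3 + 18 * x ^+ 2 - 4 * x - 1.
Proof.
rewrite /Qpoly !(rmorphD, rmorphN) /= !map_polyZ !map_polyXn map_polyX rmorph1 /= !rmorph_nat.
by rewrite !(hornerD, hornerN, hornerZ, hornerXn, hornerX, hornerC).
Qed.

Lemma size_Qpoly : size Qpoly = 13%N.
Proof.
rewrite /Qpoly -!addrA size_polyDl size_scale ?size_polyXn // ltnS.
apply/leq_sizeP => j j12.
rewrite !(coefD, coefN, coefZ, coefXn, coefX, coef1).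
by rewrite !gtn_eqF ?(leq_trans _ j12) // !mulr0 oppr0 !addr0.
Qed.

Lemma horner_revQV (k : fieldType) (j : {rmorphism rat -> k}) (x : k) : x != 0 ->
  (map_poly intr revQ).[x^-1] * x ^+ 12 = - (map_poly j Qpoly).[x].
Proof.
move=> x0; rewrite horner_Qpoly map_revQ.
rewrite !(hornerD, hornerN, hornerZ, hornerXn, hornerX, hornerC); field; exact: x0.
Qed.

Lemma root_Qpoly_neq0 (k : fieldType) (j : {rmorphism rat -> k}) (x : k) :
  root (map_poly j Qpoly) x -> x != 0.
Proof.
rewrite /root horner_Qpoly; apply: contraTneq => ->.
by rewrite !expr0n /= !mulr0 !(addr0, subr0, add0r) oppr_eq0 oner_eq0.
Qed.

Lemma root_QpolyV (k : fieldType) (j : {rmorphism rat -> k}) (x : k) : x != 0 ->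
  root (map_poly intr revQ) x^-1 = root (map_poly j Qpoly) x.
Proof.
move=> x0; rewrite /root -[RHS]oppr_eq0 -horner_revQV // mulf_eq0 expf_eq0 /=.
by rewrite (negPf x0) orbF.
Qed.

(** The roots of [revQ] are distinct because their reductions modulo 5 are, and their inverses are
    the roots of [Qpoly]. *)
Lemma separable_Qpoly : separable_poly Qpoly.
Proof.
have revQ0 : (map_poly intr revQ : {poly rat}) != 0.
  by rewrite -size_poly_gt0 size_revQ.
have [E [rs]] := exists_splitting_field revQ0; rewrite map_intr_poly.
rewrite eqp_monic ?monic_prod_XsubC ?monic_map ?monic_revQ // => /eqP revQE.
have rs12 : size rs == 12%N by rewrite (size_roots_revQ revQE).
have [urs _] := @gal_image_revQ E (Tuple rs12) revQE.
have root_rs r : r \in rs -> root (map_poly intr revQ) r by rewrite revQE root_prod_XsubC.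
have rs0 r : r \in rs -> r != 0.
  move=> /root_rs; rewrite /root map_revQ; apply: contraTneq => ->.
  rewrite !(hornerD, hornerN, hornerZ, hornerXn, hornerX, hornerC) !expr0n /=.
  rewrite !mulr0 !(addr0, subr0, add0r) oppr_eq0 mulr1 -(rmorph_nat (in_alg E)).
  by rewrite fmorph_eq0.
have uV : uniq [seq r^-1 | r <- rs] by rewrite (map_inj_uniq invr_inj).
rewrite -(separable_map (in_alg E)).
have := @all_roots_prod_XsubC _ (map_poly (in_alg E) Qpoly) [seq r^-1 | r <- rs].
rewrite size_map_poly size_Qpoly size_map (eqP rs12) uniq_rootsE uV => /(_ erefl _ isT) ->.
  by rewrite (eqp_separable (eqp_scale _ _)) ?separable_prod_XsubC // lead_coef_eq0
    map_poly_eq0 -size_poly_gt0 size_Qpoly.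
apply/allP => _ /mapP[r rrs ->].
by rewrite -root_QpolyV ?invrK ?root_rs // invr_neq0 // rs0.
Qed.

Lemma Qpoly_splits (L : fieldExtType rat) (rs : seq L) :
  map_poly (in_alg L) Qpoly %= \prod_(r <- rs) ('X - r%:P) ->
  [/\ size rs = 12%N, uniq rs
    & map_poly intr revQ = \prod_(r <- map GRing.inv rs) ('X - r%:P)].
Proof.
move=> QE.
have size_rs : size rs = 12%N.
  by have := eqp_size QE; rewrite size_map_poly size_Qpoly size_prod_XsubC => -[].
have urs : uniq rs.
  by rewrite -separable_prod_XsubC -(eqp_separable QE) separable_map separable_Qpoly.
split=> //; have := @all_roots_prod_XsubC _ (map_poly intr revQ) (map GRing.inv rs).
rewrite size_revQ size_map size_rs uniq_rootsE (map_inj_uniq invr_inj) urs => /(_ erefl _ isT) ->.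
  have /monicP-> : map_poly intr revQ \is @monic L by rewrite monic_map ?monic_revQ.
  by rewrite scale1r.
apply/allP => _ /mapP[r rrs ->].
have rQ : root (map_poly (in_alg L) Qpoly) r by rewrite (eqp_root QE) root_prod_XsubC.
by rewrite (root_QpolyV (in_alg L)) // (root_Qpoly_neq0 rQ).
Qed.

Lemma Qpoly_gal_full (L : splittingFieldType rat) (rs : 12.-tuple L) :
  map_poly (in_alg L) Qpoly %= \prod_(r <- rs) ('X - r%:P) ->
  forall s : 'S_12, exists x : gal_of {:L}, forall i, x (tnth rs i) = tnth rs (s i).
Proof.
move=> /Qpoly_splits[_ _ revQE] s.
have [_ full] := @gal_image_revQ L (map_tuple GRing.inv rs) revQE.
have : s \in gal_image (map_tuple GRing.inv rs) by rewrite full inE.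
move=> /gal_imageP[x xs]; exists x => i; apply: invr_inj.
by rewrite -fmorphV; have := xs i; rewrite !tnth_map.
Qed.

Lemma mem_gal_rat (L : splittingFieldType rat) (x : gal_of {:L}) : x \in 'Gal({:L} / 1)%g.
Proof. by rewrite gal_kHom ?sub1v // k1AHom. Qed.

Lemma Qpoly_gal_isog (L : splittingFieldType rat) :
  splittingFieldFor 1%VS (map_poly (in_alg L) Qpoly) {:L}%VS ->
  'Gal({:L} / 1)%g \isog [set: 'S_12].
Proof.
move=> [rs QE genL]; have [size_rs urs _] := Qpoly_splits QE.
have rs12 : size rs == 12%N by rewrite size_rs.
pose ts := Tuple rs12.
have /tuple_uniqP tinj : uniq ts by [].
have [f fE] := choice (@gal_permutes_roots L 12 ts Qpoly urs QE).
have fM : {in 'Gal({:L} / 1)%g &, {morph f : x y / (x * y)%g}}.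
  move=> x y _ _; apply/permP => i; apply: tinj.
  by rewrite -fE galM ?memvf // !fE permM.
apply/isogP; exists (Morphism fM).
  apply/fintype.subsetP => x /morphpreP[xG]; rewrite !inE => /eqP fx1.
  apply/eqP/eqP/gal_eqP => a _; rewrite gal_id.
  (* Injectivity: the field fixed by [x] contains the roots, which generate [L]. *)
  suff : a \in fixedField [set x] by move=> /mem_fixedFieldP[_ ->]; rewrite ?inE.
  have /subvP : (<<1 & rs>> <= fixedField [set x])%VS.
    apply/Fadjoin_seqP; split; first exact: sub1v.
    move=> r rrs; have /tnthP[i ->] : r \in ts by [].
    apply/fixedFieldP => [|y]; first exact: memvf.
    by rewrite inE => /eqP ->; rewrite fE; move: fx1 => /= ->; rewrite perm1.
  by apply; rewrite genL memvf.
apply/eqP; rewrite finset.eqEsubset finset.subsetT; apply/fintype.subsetP => s _.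
have [x xs] := Qpoly_gal_full (rs := ts) QE s; apply/morphimP; exists x; rewrite ?mem_gal_rat //=.
by apply/permP => i; apply: tinj; rewrite -fE xs.
Qed.

Lemma fact12 : 12`! = 479001600%num.
Proof. by rewrite !factS fact0; lia. Qed.

(** * Extensions of degree at most 3 *)

Lemma perm12_pow6 (i j : 'I_12) : exists s : 'S_12, (s ^+ 6)%g i = j.
Proof.
have [<-|ij] := eqVneq i j; first by exists 1%g; rewrite expg1n perm1.
(* If [c] has order 11, then [c] is its own twelfth power, hence the sixth power of its square; it
   remains to conjugate [c] so that it sends [i] to [j]. *)
have [||c _ c11] := @Cauchy _ 11 [set: 'S_12]%G; first by [].
  by rewrite cardsT card_Sn dvdn_fact.
have [b cb] : exists b, c b != b.
  apply/existsP; have : c != 1%g by rewrite -order_gt1 c11.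
  apply: contraNT; rewrite negb_exists => /forallP cid.
  by apply/eqP/permP => b; rewrite perm1; apply/eqP; have := cid b; rewrite negbK.
(* [u] sends [b] to [i] and [c b] to [j], the second transposition fixing [i]. *)
pose t1 := tperm b i; pose u := (t1 * tperm (t1 (c b)) j)%g.
have ub : u b = i.
  have t1cb : t1 (c b) != i by rewrite -(tpermL b i) (inj_eq perm_inj).
  by rewrite permM tpermL tpermD // eq_sym.
have ucb : u (c b) = j by rewrite permM tpermL.
have cu11 : ((c ^ u) ^+ 11 = 1)%g by have := expg_order c; rewrite c11 -conjXg => ->; rewrite conj1g.
exists ((c ^ u) ^+ 2)%g; rewrite -expgM -[(2 * 6)%N]/(11 + 1)%N expgD cu11.
by rewrite mul1g expg1 -ub permJ.
Qed.

Lemma irreducible_Qpoly (K : fieldExtType rat) : (\dim {:K} <= 3)%N ->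
  irreducible_poly (map_poly (in_alg K) Qpoly).
Proof.
move=> dimK; have [theta gen] := rat_primitive_element K.
have [m mE _] := rat_minPoly theta.
have size_m : size m = (\dim {:K}).+1.
  by rewrite -(size_map_poly (in_alg K)) mE size_minPoly adjoin_degreeE gen dimv1 divn1.
have m_gt1 : (1 < size m)%N by rewrite size_m ltnS adim_gt0.
have m0 : m != 0 by rewrite -size_poly_gt0 ltnW.
have Q0 : Qpoly != 0 by rewrite -size_poly_gt0 size_Qpoly.
(* A splitting field of [Qpoly * m] contains the roots of [Qpoly] as well as an image of [K]. *)
have [E [es]] := exists_splitting_field (mulf_neq0 Q0 m0).
rewrite rmorphM /= => esE.
have [z mz] : exists z, root (map_poly (in_alg E) m) z.
  have [|mk mkE] := @dvdp_prod_XsubC _ _ es id (map_poly (in_alg E) m).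
    by rewrite -(eqp_dvdr _ esE) dvdp_mull.
  have := eqp_size mkE; rewrite size_prod_XsubC size_map_poly.
  case mkes : (mask mk es) => [|z zs]; first by move=> m1; rewrite m1 in m_gt1.
  by move=> _; exists z; rewrite (eqp_root mkE) root_prod_XsubC mkes mem_head.
have [rs QE] : exists rs, map_poly (in_alg E) Qpoly %= \prod_(r <- rs) ('X - r%:P).
  have [|mk mkE] := @dvdp_prod_XsubC _ _ es id (map_poly (in_alg E) Qpoly).
    by rewrite -(eqp_dvdr _ esE) dvdp_mulr.
  by exists (mask mk es).
have [size_rs urs _] := Qpoly_splits QE.
have rs12 : size rs == 12%N by rewrite size_rs.
pose ts := Tuple rs12.
have [kappa kz] := exists_rmorphism_root gen mE mz.
have galX (x : gal_of {:E}) n a : (x ^+ n)%g a = iter n x a.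
  by elim: n => [|n IH]; rewrite ?expg0 ?gal_id // expgSr galM ?memvf // IH.
(* The conjugates of [z] number at most 3, so some power [x ^+ i] with
   [1 <= i <= 3] fixes it, hence so does [x ^+ 6]. *)
have x6 (x : gal_of {:E}) : (x ^+ 6)%g z = z.
  have rx a : root (map_poly (in_alg E) m) a -> root (map_poly (in_alg E) m) (x a).
    by rewrite -[in X in _ -> X](gal_map_rat_poly x) fmorph_root.
  have : ~~ uniq [:: z; x z; x (x z); x (x (x z))].
    apply/negP => uz; have := @max_poly_roots _ (map_poly (in_alg E) m) _ _ _ uz.
    rewrite map_poly_eq0 m0 /= !rx // mz => /(_ isT isT).
    by rewrite size_map_poly size_m ltnS => lt3; have := leq_trans lt3 dimK.
  rewrite galX /= !inE !negb_or !(inj_eq (fmorph_inj x)) !andbT !negb_and !negbK.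
  have [xz|_ ] := eqVneq z (x z); first by rewrite -!xz.
  have [xz|_ ] := eqVneq z (x (x z)); first by rewrite -!xz.
  have [xz|_ ] := eqVneq z (x (x (x z))); first by rewrite -!xz.
  by [].
have trans i j : exists2 y : gal_of {:E}, y z = z & y (tnth ts i) = tnth ts j.
  have [s <-] := perm12_pow6 i j; have [x xs] := Qpoly_gal_full (rs := ts) QE s.
  suff sE n : iter n x (tnth ts i) = tnth ts ((s ^+ n)%g i).
    by exists (x ^+ 6)%g; rewrite // galX sE.
  by elim: n => [|n IH]; rewrite ?expg0 ?perm1 // expgSr permM -xs -IH.
split=> [|q size_q dvq]; first by rewrite size_map_poly size_Qpoly.
have q0 : q != 0 by apply: contraTneq dvq => ->; rewrite dvd0p map_poly_eq0.
have kQ : map_poly kappa (map_poly (in_alg K) Qpoly) = map_poly (in_alg E) Qpoly.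
  by rewrite -map_poly_comp; apply: eq_map_poly => a; rewrite /= !alg_num_field fmorph_rat.
have [i ri] : exists i, root (map_poly kappa q) (tnth ts i).
  have [|mk mkE] := @dvdp_prod_XsubC _ _ rs id (map_poly kappa q).
    by rewrite -(eqp_dvdr _ QE) -kQ dvdp_map.
  have := eqp_size mkE; rewrite size_prod_XsubC size_map_poly.
  case mkes : (mask mk rs) => [|r0 zs]; first by move=> q1; rewrite q1 in size_q.
  have /tnthP[i iE] : r0 \in ts by apply: (@mem_mask _ _ mk); rewrite mkes mem_head.
  by move=> _; exists i; rewrite -iE (eqp_root mkE) root_prod_XsubC mkes mem_head.
(* The automorphism [y] fixes [z], hence the image of [K] and the coefficients of [q]; so it maps
   roots of [q] to roots of [q], and transitivity reaches all twelve. *)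
have all_roots : all (root (map_poly kappa q)) rs.
  apply/allP => r rrs; have /tnthP[j ->] : r \in ts by [].
  have [y yz <-] := trans i j.
  suff <- : map_poly y (map_poly kappa q) = map_poly kappa q by rewrite fmorph_root.
  apply/polyP => l; rewrite !coef_map /=.
  have /Fadjoin_polyP[g /polyOver1P[g' ->] ->] : q`_l \in <<1; theta>>%VS by rewrite gen memvf.
  rewrite -horner_map kz -map_poly_comp -horner_map /= yz -map_poly_comp.
  by congr _.[_]; apply: eq_map_poly => a; rewrite /= !alg_num_field !fmorph_rat.
rewrite -dvdp_size_eqp // eqn_leq dvdp_leq ?map_poly_eq0 //=.
rewrite size_map_poly size_Qpoly -size_rs -(size_map_poly kappa).
by apply: max_poly_roots; rewrite // map_poly_eq0.
Qed.

Lemma irreducible_Qpoly_rat : irreducible_poly Qpoly.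
Proof.
have := @irreducible_Qpoly rat^o; rewrite dimvf /= => /(_ isT).
by rewrite map_poly_id // => a _; rewrite /= /GRing.scale /= mulr1.
Qed.

(** * Best quadratic approximation *)

Section QuadraticApproximation.
Variable R : realType.
Implicit Types (h g : {poly R}) (t : R).

Lemma sqrt1D_gt0 t : 0 < Num.sqrt (1 + t ^+ 2) :> R.
Proof. by rewrite sqrtr_gt0 ltr_pwDl ?ltr01 ?sqr_ge0. Qed.

Lemma sqr_sqrt1D t : Num.sqrt (1 + t ^+ 2) ^+ 2 = 1 + t ^+ 2 :> R.
Proof. by rewrite sqr_sqrtr // addr_ge0 ?ler01 ?sqr_ge0. Qed.

(** The supremum is an upper bound only of a bounded set: the polynomial is bounded on [0, 1] and
    the denominator is at least 1. *)
Lemma relerr_le_maxerr h t : 0 <= t <= 1 -> `|relerr h t| <= maxerr h.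
Proof.
move=> t01; apply: ub_le_sup; last by exists t.
have [C hC] := poly_itv_bound h 0 1.
exists (C + 1) => _ [u u01 <-]; rewrite (le_trans (ler_normB _ _)) // normr1 lerD2r.
have C0 : 0 <= C := le_trans (normr_ge0 _) (hC u u01).
rewrite normrM normfV (gtr0_norm (sqrt1D_gt0 u)) ler_pdivrMr ?sqrt1D_gt0 //.
apply: le_trans (hC u u01) _; rewrite ler_peMr // -[leLHS]sqrtr1 ler_sqrt.
  by rewrite lerDl sqr_ge0.
by rewrite addr_ge0 ?ler01 ?sqr_ge0.
Qed.

Lemma maxerr_eq h (e : R) t0 : 0 <= t0 <= 1 -> `|relerr h t0| = e ->
  (forall t, 0 <= t <= 1 -> `|relerr h t| <= e) -> maxerr h = e.
Proof.
move=> t01 he le_e; apply/eqP; rewrite eq_le -{2}he relerr_le_maxerr // andbT.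
apply: ge_sup; first by exists `|relerr h t0|, t0.
by move=> _ [t t01' <-]; exact: le_e.
Qed.

Lemma size3_horner (d : {poly R}) t : (size d <= 3)%N ->
  d.[t] = d`_0 + d`_1 * t + d`_2 * t ^+ 2.
Proof.
move=> /horner_coef_wide ->; rewrite !big_ord_recr big_ord0 /=; ring.
Qed.

(* The third divided difference at [0, x, y, 1] of a polynomial of degree at
   most 2 vanishes, and all its terms have the same sign. *)
Lemma alternating_quadratic_eq0 (d : {poly R}) (x y : R) : (size d <= 3)%N ->
  0 < x -> x < y -> y < 1 ->
  0 <= d.[0] -> d.[x] <= 0 -> 0 <= d.[y] -> d.[1] <= 0 -> d = 0.
Proof.
move=> sd x0 xy y1 d0 dx dy d1.
(* The weights of the divided difference, multiplied by -x y (y - x) (1 - x) (1 - y) to clear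
   denominators. *)
pose w0 := (y - x) * (1 - x) * (1 - y); pose w1 := y * (1 - y).
pose w2 := x * (1 - x); pose w3 := x * y * (y - x).
have w0P : 0 < w0 by rewrite /w0 !mulr_gt0 ?subr_gt0 // (lt_trans xy).
have w1P : 0 < w1 by rewrite /w1 !mulr_gt0 ?subr_gt0 // (lt_trans x0).
have w2P : 0 < w2 by rewrite /w2 !mulr_gt0 ?subr_gt0 // (lt_trans xy).
have w3P : 0 < w3 by rewrite /w3 !mulr_gt0 ?subr_gt0 // (lt_trans x0).
have dd : w0 * d.[0] - w1 * d.[x] + w2 * d.[y] - w3 * d.[1] = 0.
  by rewrite !size3_horner // /w0 /w1 /w2 /w3; ring.
have p0 := mulr_ge0 (ltW w0P) d0; have p2 := mulr_ge0 (ltW w2P) dy.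
have p1 : 0 <= - (w1 * d.[x]) by rewrite -mulrN mulr_ge0 ?oppr_ge0 // ltW.
have p3 : 0 <= - (w3 * d.[1]) by rewrite -mulrN mulr_ge0 ?oppr_ge0 // ltW.
have e0 : w0 * d.[0] = 0 by lra.
have e1 : w1 * d.[x] = 0 by lra.
have e2 : w2 * d.[y] = 0 by lra.
have r0 : root d 0 by move/eqP: e0; rewrite mulf_eq0 (gt_eqF w0P).
have r1 : root d x by move/eqP: e1; rewrite mulf_eq0 (gt_eqF w1P).
have r2 : root d y by move/eqP: e2; rewrite mulf_eq0 (gt_eqF w2P).
apply: contraTeq sd => dn0; rewrite -ltnNge.
apply: (@max_poly_roots _ d [:: 0; x; y]) => //=; first by rewrite r0 r1 r2.
by rewrite !inE !negb_or !andbT !lt_eqF // (lt_trans x0).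
Qed.

(** Where the error of [h] is extremal, that of [g] is no larger in absolute value, so [g - h]
    vanishes or has the sign opposite to the error of [h]. These signs alternate at four points. *)
Lemma alternation_unique h g (t1 t2 : R) :
  (size h <= 3)%N -> alternation_points h t1 t2 ->
  (size g <= 3)%N -> maxerr g <= maxerr h -> g = h.
Proof.
move=> sh [t10 t12 t21 eqset [s01 s12 s23]] sg le_gh.
have mem t : t \in [:: 0; t1; t2; 1] -> 0 <= t <= 1 /\ `|relerr h t| = maxerr h.
  by move=> tin; have : [set t : R | t \in [:: 0; t1; t2; 1]]%classic t by []; rewrite -eqset.
have sgn t : t \in [:: 0; t1; t2; 1] ->
    (relerr h t < 0 -> 0 <= (g - h).[t]) /\ (0 < relerr h t -> (g - h).[t] <= 0).
  move=> /mem[t01 het]; have := le_trans (relerr_le_maxerr g t01) le_gh.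
  have diff : relerr g t - relerr h t = (g - h).[t] / Num.sqrt (1 + t ^+ 2).
    by rewrite /relerr hornerD hornerN; ring.
  rewrite -het ler_norml => /andP[geh leh].
  split=> [ht|ht].
    rewrite (ltr0_norm ht) opprK in geh; move: geh; rewrite -subr_ge0 diff.
    by rewrite pmulr_lge0 // invr_gt0 sqrt1D_gt0.
  rewrite (gtr0_norm ht) in leh; move: leh; rewrite -subr_le0 diff.
  by rewrite pmulr_lle0 // invr_gt0 sqrt1D_gt0.
have [sgn0 sgn0'] := sgn 0 (mem_head _ _).
have [|sgn1 sgn1'] := sgn t1; first by rewrite !inE eqxx orbT.
have [|sgn2 sgn2'] := sgn t2; first by rewrite !inE eqxx !orbT.
have [|sgn3 sgn3'] := sgn 1; first by rewrite !inE eqxx !orbT.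
have sd : (size (g - h)%R <= 3)%N.
  by rewrite (leq_trans (size_polyD _ _)) // size_polyN geq_max sg.
have prod_lt0 (u v : R) : u * v < 0 -> u < 0 /\ 0 < v \/ 0 < u /\ v < 0.
  case: (ltgtP u 0) => [u0|u0|->]; last by rewrite mul0r ltxx.
    by rewrite nmulr_rlt0 //; left.
  by rewrite pmulr_rlt0 //; right.
apply/eqP; rewrite -subr_eq0; apply/eqP.
have [[n0 p1]|[p0 n1]] := prod_lt0 _ _ s01.
  have n2 : relerr h t2 < 0 by rewrite pmulr_rlt0 in s12.
  have p3 : 0 < relerr h 1 by rewrite nmulr_rlt0 in s23.
  by apply: (alternating_quadratic_eq0 sd t10 t12 t21); auto.
have p2 : 0 < relerr h t2 by rewrite nmulr_rlt0 in s12.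
have n3 : relerr h 1 < 0 by rewrite pmulr_rlt0 in s23.
(* The other sign pattern is reduced to the first by negating the difference. *)
apply/eqP; rewrite -oppr_eq0; apply/eqP.
apply: (alternating_quadratic_eq0 _ t10 t12 t21); rewrite ?size_polyN // hornerN ?oppr_ge0 ?oppr_le0; auto.
Qed.

End QuadraticApproximation.

(* With [x = (3 - v^2) / (2 v)] one has [sqrt (3 + x^2) = (3 + v^2) / (2 v)], which
   makes the solution [y] of [(1 + x^2 + x y)^2 = 1 + y^2] rational in [v].
   [paramN] is then the essential factor of the numerator of the equation
   [h(1)^2 / 2 = h(x)^2 / (1 + x^2)], and it divides that of [Qpoly] at [x]. *)
Definition paramN (R : pzRingType) (v : R) : R :=
  729 - 3888 * v + 5994 * v ^+ 2 - 1728 * v ^+ 3 - 4419 * v ^+ 4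
  + 4752 * v ^+ 5 - 820 * v ^+ 6 - 1600 * v ^+ 7 + 1355 * v ^+ 8 - 480 * v ^+ 9
  + 74 * v ^+ 10 - v ^+ 12.

Lemma exists_paramN_root (R : rcfType) :
  exists v : R, [/\ 3 / 2 <= v, v <= 8 / 5 & paramN v = 0].
Proof.
pose p : {poly R} := 729 *: 1 - 3888 *: 'X + 5994 *: 'X^2 - 1728 *: 'X^3 - 4419 *: 'X^4
  + 4752 *: 'X^5 - 820 *: 'X^6 - 1600 *: 'X^7 + 1355 *: 'X^8 - 480 *: 'X^9
  + 74 *: 'X^10 - 'X^12.
have pE v : p.[v] = paramN v.
  by rewrite /p /paramN !(hornerD, hornerN, hornerZ, hornerXn, hornerX, hornerC) mulr1.
have [||v /andP[v32 v85]] := @poly_ivt R p (3 / 2) (8 / 5); first by lra.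
  by rewrite !pE /paramN; apply/andP; split; lra.
by rewrite /root pE => /eqP pv; exists v.
Qed.

Section Param.
Variables (R : numFieldType) (v : R).
Hypotheses (v0 : v != 0) (v1 : v - 1 != 0) (v3 : 3 - v != 0).

Let x := (3 - v ^+ 2) / (2 * v).
Let y := (3 - v ^+ 2) * (v ^+ 2 - 2 * v + 3) / (2 * v * (v - 1) * (3 - v)).

(** Equality of the errors at 0 and t2, for t1 = x and t2 = y: with s = x^2 + x y and w the square
    root of 1 + y^2, it reads (w - 1) (w - 1 - s) = 0. Solving w = 1 + s for y requires the square
    root of 3 + x^2. *)
Lemma param_relation1 : (1 + x ^+ 2 + x * y) ^+ 2 = 1 + y ^+ 2.
Proof. by rewrite /x /y; field; rewrite v0 v1 v3. Qed.

(** When [paramN v] vanishes, this says that the errors at t1 and 1 agree, the values there being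
    positive. *)
Lemma param_relation2 :
  2 * (1 + x ^+ 2) * (2 + y ^+ 2 + x * y) ^+ 2 =
    (3 + x ^+ 2 + x * y + y ^+ 2 + x * y * (x + y)) ^+ 2
    - (v + 3) ^+ 2 / (8 * v ^+ 4 * (v - 1) ^+ 2 * (3 - v) ^+ 4) * paramN v.
Proof. by rewrite /x /y /paramN; field; rewrite v0 v1 v3. Qed.

Lemma param_Qpoly :
  4 * x ^+ 12 - 32 * x ^+ 11 + 36 * x ^+ 10 + 56 * x ^+ 9
    + 211 * x ^+ 8 + 228 * x ^+ 7 + 250 * x ^+ 6 + 136 * x ^+ 5 + 81 * x ^+ 4
    + 32 * x ^+ 3 + 18 * x ^+ 2 - 4 * x - 1 =
  - (- (54 * 54) + 216 * 111 * v ^+ 2 + 216 * 240 * v ^+ 3 + 180 * 271 * v ^+ 4 + 160 * 120 * v ^+ 5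
    - 40 * 82 * v ^+ 6 - 66 * 96 * v ^+ 7 - 4 * 491 * v ^+ 8 + 256 * v ^+ 9 + 296 * v ^+ 10
    + 64 * v ^+ 11 + 4 * v ^+ 12) / (2 * v) ^+ 12 * paramN v.
Proof. by rewrite /x /paramN; field; rewrite v0. Qed.
End Param.

Lemma exists_alternation_param (R : realType) : exists t1 t2 : R,
  [/\ 0 < t1, t1 < t2 & t2 < 1] /\
  [/\ (1 + t1 ^+ 2 + t1 * t2) ^+ 2 = 1 + t2 ^+ 2,
      2 * (1 + t1 ^+ 2) * (2 + t2 ^+ 2 + t1 * t2) ^+ 2 =
        (3 + t1 ^+ 2 + t1 * t2 + t2 ^+ 2 + t1 * t2 * (t1 + t2)) ^+ 2
    & root (map_poly ratr Qpoly) t1].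
Proof.
have [v [v32 v85 Nv]] := exists_paramN_root R.
have v0 : v != 0 by lra.
have v1 : v - 1 != 0 by lra.
have v3 : 3 - v != 0 by lra.
exists ((3 - v ^+ 2) / (2 * v)).
exists ((3 - v ^+ 2) * (v ^+ 2 - 2 * v + 3) / (2 * v * (v - 1) * (3 - v))).
have vv : 0 < 3 - v ^+ 2.
  have : v ^+ 2 <= (8 / 5) ^+ 2 by rewrite lerXn2r // nnegrE; lra.
  by rewrite subr_gt0 => /le_lt_trans; apply; lra.
have D0 : 0 < 2 * v * (v - 1) * (3 - v) by rewrite !mulr_gt0 //; lra.
split; last first.
  split; first exact: param_relation1.
    by rewrite param_relation2 // Nv mulr0 subr0.
  by rewrite /root horner_Qpoly param_Qpoly // Nv mulr0.
clear Nv; split.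
- by rewrite divr_gt0 //; lra.
- rewrite -subr_gt0.
  have -> : (3 - v ^+ 2) * (v ^+ 2 - 2 * v + 3) / (2 * v * (v - 1) * (3 - v))
      - (3 - v ^+ 2) / (2 * v)
    = (3 - v ^+ 2) * (2 * v ^+ 2 - 6 * v + 6) / (2 * v * (v - 1) * (3 - v)).
    by field; rewrite v0 v1 v3.
  have -> : 2 * v ^+ 2 - 6 * v + 6 = 2 * (v - 3 / 2) ^+ 2 + 3 / 2 :> R by field.
  by rewrite divr_gt0 // mulr_gt0 // ltr_wpDl ?mulr_ge0 ?sqr_ge0 //; lra.
rewrite ltr_pdivrMr // mul1r -subr_gt0.
(* The numerator of 1 - t2 is a nonzero square plus a multiple of v^2 - 9/4, which is nonnegative as
   v is at least 3/2. *)
have -> : 2 * v * (v - 1) * (3 - v) - (3 - v ^+ 2) * (v ^+ 2 - 2 * v + 3) =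
  v ^+ 2 * (v - 2) ^+ 2 + 4 * (v - 3 / 2) * (v + 3 / 2) by field.
rewrite ltr_pwDl //; last by rewrite !mulr_ge0 //; lra.
by rewrite -exprMn lt0r sqr_ge0 expf_eq0 /= mulf_neq0 //; lra.
Qed.

(* [H] is chosen so that the derivative of [H / sqrt (1 + t^2)] vanishes at [t1]
   and [t2]. The identities [lower] and [upper] then say that [H / sqrt (1 + t^2)]
   stays between [a] and [m], and is equal to them only at the alternation points. *)
Lemma exists_alternation (R : realType) : exists (h : {poly R}) (t1 t2 : R),
  [/\ (size h <= 3)%N, alternation_points h t1 t2 & root (map_poly ratr Qpoly) t1].
Proof.
have [t1 [t2 [[t10 t12 t21] [P1 P2 Qt1]]]] := exists_alternation_param R.
have t20 := lt_trans t10 t12; have t11 := lt_trans t12 t21.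
(* The third root of t^3 + (2 - a) t + b is -(t1 + t2), which determines [a] and [b]; [m] is the
   common value of H / sqrt (1 + t^2) at t1 and 1. *)
pose a := 2 + t1 ^+ 2 + t1 * t2 + t2 ^+ 2.
pose b := t1 * t2 * (t1 + t2).
pose H t := t ^+ 2 + b * t + a.
pose m := H 1 / Num.sqrt 2.
have a0 : 0 < a by rewrite /a; nra.
have b0 : 0 < b by rewrite /b !mulr_gt0 // addr_gt0.
have m0 : 0 < m by rewrite divr_gt0 ?sqrtr_gt0 // /H; lra.
have m2 : m ^+ 2 = (1 + t1 ^+ 2) * (2 + t2 ^+ 2 + t1 * t2) ^+ 2.
  rewrite /m exprMn exprVn sqr_sqrtr //; apply: (mulIf (x := 2)); first by rewrite pnatr_eq0.
  rewrite mulfVK ?pnatr_eq0 // mulrC mulrA P2 /H /a /b; ring.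
have lower t : H t ^+ 2 - a ^+ 2 * (1 + t ^+ 2) =
    t * (t - t2) ^+ 2 * (t + (2 * b + 2 * t2)).
  (* The other coefficients agree identically; only those of t and t^2 depend on [P1]. *)
  suff d0 : a * b = (b + t2) * t2 ^+ 2 /\
      b ^+ 2 + 2 * a - a ^+ 2 = t2 ^+ 2 - 4 * (b + t2) * t2.
    case: d0 => ab bb; apply/eqP; rewrite -subr_eq0; apply/eqP.
    have -> : H t ^+ 2 - a ^+ 2 * (1 + t ^+ 2) - t * (t - t2) ^+ 2 * (t + (2 * b + 2 * t2)) =
      t * (2 * (a * b - (b + t2) * t2 ^+ 2) +
        t * (b ^+ 2 + 2 * a - a ^+ 2 - (t2 ^+ 2 - 4 * (b + t2) * t2))).
      by rewrite /H; ring.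
    by rewrite ab bb !subrr !mulr0 addr0 mulr0.
  pose s := t1 ^+ 2 + t1 * t2.
  have t2E : t2 ^+ 2 = s ^+ 2 + 2 * s.
    by apply: (addrI 1); rewrite -P1 /s; ring.
  have bE : b = s * t2 by rewrite /b /s; ring.
  have aE : a = (s + 1) * (s + 2).
    by transitivity (2 + s + t2 ^+ 2); [rewrite /a /s; ring | rewrite t2E; ring].
  split.
    transitivity ((s + 1) * t2 * (s ^+ 2 + 2 * s)); first by rewrite aE bE; ring.
    by rewrite -t2E bE; ring.
  transitivity (s ^+ 2 * t2 ^+ 2 + a * (2 - a)); first by rewrite bE; ring.
  transitivity (t2 ^+ 2 - 4 * (s + 1) * t2 ^+ 2); last by rewrite bE; ring.
  by rewrite aE t2E; ring.
have upper t : H t ^+ 2 - m ^+ 2 * (1 + t ^+ 2) =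
    (t - t1) ^+ 2 * (t - 1) * (t + (2 * b + 2 * t1 + 1)).
  pose al := 2 * b + 2 * t1.
  (* The double root [t1] splits off identically, leaving a quadratic factor; the root 1, supplied
     by [P2], then determines [be]. *)
  pose be := b ^+ 2 + 2 * a - m ^+ 2 + 2 * t1 * al - t1 ^+ 2.
  have fact u : H u ^+ 2 - m ^+ 2 * (1 + u ^+ 2) = (u - t1) ^+ 2 * (u ^+ 2 + al * u + be).
    by rewrite /be /al m2 /H /a /b; ring.
  have : (1 - t1) ^+ 2 * (1 + al + be) = 0.
    have := fact 1; rewrite !expr1n mulr1 => <-.
    rewrite m2; apply/eqP; rewrite subr_eq0; apply/eqP.
    transitivity (2 * (1 + t1 ^+ 2) * (2 + t2 ^+ 2 + t1 * t2) ^+ 2); last by ring.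
    by rewrite P2 /H /a /b; ring.
  move=> /eqP; rewrite mulf_eq0 expf_eq0 /= subr_eq0 gt_eqF //= => /eqP be0.
  have beE : be = - 1 - al by move: be0; lra.
  by rewrite fact beE /al; ring.
(* Both identities are compared at [t1], where [upper] vanishes and [lower] is positive. *)
have ma : a < m.
  have := lower t1; have := upper t1; rewrite subrr expr0n /= !mul0r => /eqP.
  rewrite subr_eq0 => /eqP -> low.
  have : 0 < t1 * (t1 - t2) ^+ 2 * (t1 + (2 * b + 2 * t2)).
    apply: mulr_gt0; last by lra.
    by apply: mulr_gt0; rewrite // lt0r sqr_ge0 expf_eq0 /= subr_eq0 lt_eqF.
  rewrite -low -mulrBl pmulr_lgt0; last by nra.
  by rewrite subr_gt0 ltr_pXn2r // nnegrE ltW.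
(* This scaling makes the extreme values c a and c m symmetric about 1, at distance [E]. *)
pose c := 2 / (a + m).
pose h : {poly R} := c *: ('X^2 + b *: 'X + a%:P).
have hE t : h.[t] = c * H t.
  by rewrite /h /H !(hornerD, hornerZ, hornerXn, hornerX, hornerC).
pose E := (m - a) / (m + a).
have E0 : 0 < E by apply: divr_gt0; [rewrite subr_gt0 | apply: addr_gt0].
pose u t := H t / Num.sqrt (1 + t ^+ 2).
have errE t : relerr h t = E - c * (m - u t).
  rewrite /relerr hE -mulrA -/(u t) /E /c; field; lra.
have errE' t : relerr h t = - E + c * (u t - a).
  rewrite /relerr hE -mulrA -/(u t) /E /c; field; lra.
have c0 : 0 < c by apply: divr_gt0 => //; apply: addr_gt0.
have H0 t : 0 <= t -> 0 < H t by move=> t0; rewrite /H; nra.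
have u0 t : 0 <= t -> 0 < u t by move=> t0; rewrite /u divr_gt0 ?sqrt1D_gt0 ?H0.
have u2 t (w : R) : u t ^+ 2 - w ^+ 2 = (H t ^+ 2 - w ^+ 2 * (1 + t ^+ 2)) / (1 + t ^+ 2).
  rewrite /u exprMn exprVn sqr_sqrt1D mulrBl mulfK //.
  by rewrite -sqr_sqrt1D expf_eq0 /= gt_eqF ?sqrt1D_gt0.
have s0 (t : R) : 0 < 1 + t ^+ 2 by rewrite -sqr_sqrt1D exprn_gt0 ?sqrt1D_gt0.
have sqr_le (x y : R) : 0 < x -> 0 < y -> (x <= y) = (x ^+ 2 <= y ^+ 2).
  by move=> x0 y0; rewrite ler_sqr // nnegrE ltW.
have au t : 0 <= t <= 1 -> a <= u t.
  move=> /andP[t0 _]; rewrite sqr_le ?u0 // -subr_ge0 u2 lower.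
  rewrite divr_ge0 ?(ltW (s0 t)) // mulr_ge0 //; last by lra.
  by rewrite mulr_ge0 // sqr_ge0.
have um t : 0 <= t <= 1 -> u t <= m.
  move=> /andP[t0 t1']; rewrite sqr_le ?u0 // -subr_le0 u2 upper.
  rewrite mulr_le0_ge0 ?invr_ge0 ?(ltW (s0 t)) // mulr_le0_ge0 //; last by lra.
  by rewrite mulr_ge0_le0 ?sqr_ge0 // subr_le0.
have sqr_inj (x y : R) : 0 < x -> 0 < y -> (x == y) = (x ^+ 2 - y ^+ 2 == 0).
  by move=> x0 y0; rewrite subr_eq0 eqrXn2 // ltW.
have ua t : 0 <= t <= 1 -> (u t == a) = (t == 0) || (t == t2).
  move=> /andP[t0 _]; rewrite sqr_inj ?u0 // u2 lower mulf_eq0 invr_eq0 (gt_eqF (s0 t)) orbF.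
  rewrite !mulf_eq0 orbb subr_eq0 [t + _ == 0]gt_eqF ?orbF //; lra.
have uM t : 0 <= t <= 1 -> (u t == m) = (t == t1) || (t == 1).
  move=> /andP[t0 _]; rewrite sqr_inj ?u0 // u2 upper mulf_eq0 invr_eq0 (gt_eqF (s0 t)) orbF.
  rewrite !mulf_eq0 orbb !subr_eq0 [t + _ == 0]gt_eqF ?orbF //; lra.
have le_err t : 0 <= t <= 1 -> `|relerr h t| <= E.
  move=> t01; rewrite ler_norml {1}errE' errE lerDl mulr_ge0 ?subr_ge0 ?au ?(ltW c0) //=.
  by rewrite gerBl mulr_ge0 ?subr_ge0 ?um // ltW.
have err_lo t : 0 <= t <= 1 -> (t == 0) || (t == t2) -> relerr h t = - E.
  by move=> t01; rewrite -ua // => /eqP uta; rewrite errE' uta subrr mulr0 addr0.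
have err_hi t : 0 <= t <= 1 -> (t == t1) || (t == 1) -> relerr h t = E.
  by move=> t01; rewrite -uM // => /eqP uta; rewrite errE uta subrr mulr0 subr0.
have I0 : 0 <= (0 : R) <= 1 by rewrite lexx ler01.
have I1 : 0 <= t1 <= 1 by rewrite !ltW.
have I2 : 0 <= t2 <= 1 by rewrite !ltW.
have I3 : 0 <= (1 : R) <= 1 by rewrite lexx ler01.
have e0 := err_lo _ I0 (introT orP (or_introl (eqxx _))).
have e1 := err_hi _ I1 (introT orP (or_introl (eqxx _))).
have e2 := err_lo _ I2 (introT orP (or_intror (eqxx _))).
have e3 := err_hi _ I3 (introT orP (or_intror (eqxx _))).
have maxE : maxerr h = E.
  by apply: (maxerr_eq I3) => //; rewrite e3 gtr0_norm.
exists h, t1, t2; split=> //.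
  rewrite /h (leq_trans (size_scale_leq _ _)) //.
  rewrite -addrA size_polyDl ?size_polyXn // ltnS.
  rewrite (leq_trans (size_polyD _ _)) // geq_max (leq_trans (size_scale_leq _ _)) ?size_polyX //.
  by rewrite (leq_trans (size_polyC_leq1 _)).
split=> //; last by rewrite e0 e1 e2 e3; split; nra.
apply/seteqP; split=> t /=; rewrite maxE !inE.
  move=> [t01] /eqP; rewrite eqr_norml => /andP[/orP[]/eqP te _].
    have : c * (m - u t) = 0 by move: te; rewrite errE; lra.
    move=> /eqP; rewrite mulf_eq0 gt_eqF //= subr_eq0 eq_sym uM //.
    by case/orP => ->; rewrite ?orbT.
  have : c * (u t - a) = 0 by move: te; rewrite errE'; lra.
  move=> /eqP; rewrite mulf_eq0 gt_eqF //= subr_eq0 ua //.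
  by case/orP => ->; rewrite ?orbT.
by case/or4P => /eqP ->; rewrite ?e0 ?e1 ?e2 ?e3 ?normrN gtr0_norm.
Qed.

(** A competitor no worse than the alternating [h] equals [h], which yields both optimality and
    uniqueness. *)
Lemma best_quadratic_exists (R : realType) : exists h : {poly R},
  [/\ best_quadratic h, forall g, best_quadratic g -> g = h
    & exists t1 t2 : R, alternation_points h t1 t2 /\ root (map_poly ratr Qpoly) t1].
Proof.
have [h [t1 [t2 [sh alt Qt1]]]] := exists_alternation R.
have unq (g : {poly R}) : (size g <= 3)%N -> maxerr g <= maxerr h -> g = h.
  by move=> sg; apply: alternation_unique sh alt sg.
exists h; split; last by exists t1, t2.
  split=> // g sg; have [le_gh|/ltW //] := leP (maxerr g) (maxerr h).
  by rewrite (unq g).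
by move=> g [sg gbest]; apply: unq => //; exact: gbest.
Qed.

Theorem theorem2 (R : realType) :
  [/\ (exists! h : {poly R}, best_quadratic h) /\
      (forall h : {poly R}, best_quadratic h ->
        exists t1 t2 : R,
          alternation_points h t1 t2 /\ root (map_poly ratr Qpoly) t1),
      irreducible_poly Qpoly,
      (forall L : splittingFieldType rat,
        splittingFieldFor 1%VS (map_poly (in_alg L) Qpoly) {:L}%VS ->
        'Gal({:L} / 1)%g \isog [set: 'S_12] /\
        #|'Gal({:L} / 1)%g| = 479001600%num)
    & (forall K : fieldExtType rat,
        \dim {:K}%VS = 2%N \/ \dim {:K}%VS = 3%N ->
        irreducible_poly (map_poly (in_alg K) Qpoly))].
Proof.
split.
- have [h [best_h unq_h exists_t]] := best_quadratic_exists R.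
  split=> [|g /unq_h -> //].
  by exists h; split=> // g /unq_h ->.
- exact: irreducible_Qpoly_rat.
- move=> L splitL; have iso := Qpoly_gal_isog splitL; split; first exact: iso.
  apply: etrans (card_isog iso) _; rewrite cardsT card_Sn; exact: fact12.
by move=> K dimK; apply: irreducible_Qpoly; case: dimK => ->.
Qed.
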